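(* For an integer $n\ge 3$ let $I_n=(x(y^n-z^n),\,y(z^n-x^n),\,z(x^n-y^n))\subset \mathbb{C}[x,y,z]$. Then for all $n\ge 3$ and $m\ge 1$, $\omega(I_n^{(m)})\ge m(n+1)$. Moreover, for each $n\ge 3$, $\omega(I_n^{(m)})=m(n+1)$ for all integers $m\ge n^2-3n+2$.
   Context: Let $R=\mathbb{C}[x,y,z]$ with the standard grading. For a homogeneous ideal $J\subseteq R$, $\omega(J)$ denotes the maximum degree of a generator in a set of minimal homogeneous generators of $J$. For a homogeneous ideal $I\subseteq R$ and an integer $m\ge 1$, the $m$-th symbolic power of $I$ is $I^{(m)}:=\bigcap_{\mathfrak{p}\in \mathrm{Ass}(R/I)} \left(I^mR_{\mathfrak{p}}\cap R\right)$. *)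

(* Defs.v *)
From HB Require Import structures.
From mathcomp Require Import all_boot all_order all_algebra.
From mathcomp Require Import boolp classical_sets reals.
From mathcomp Require Import ring_quotient fraction complex mpoly.

Set Implicit Arguments.
Unset Strict Implicit.
Unset Printing Implicit Defensive.

Import GRing.Theory.
Local Open Scope classical_set_scope.
Local Open Scope ring_scope.

(* The A-linear combinations of elements of S. If A is a subring of T, this is
   the A-submodule of T generated by S. *)
Definition lin_span (T : comNzRingType) (A S : set T) : set T :=
  [set f | exists (k : nat) (a g : 'I_k -> T),
     [/\ forall i, A (a i), forall i, S (g i) & f = \sum_(i < k) a i * g i]].

Definition ideal_gen (T : comNzRingType) (S : set T) : set T :=
  lin_span [set: T] S.

Definition ideal_pow (T : comNzRingType) (I : set T) (m : nat) : set T :=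
  ideal_gen [set f | exists2 g : 'I_m -> T,
                       forall i, I (g i) & f = \prod_(i < m) g i].

(* idealr_closed includes 1 \notin p, so prime ideals are proper. *)
Definition prime_ideal (T : comNzRingType) (p : set T) : Prop :=
  idealr_closed (mem p) /\ prime_idealr_closed (mem p).

(* Ass(T/I): the primes that are the annihilator of the class of some f. *)
Definition associated_primes (T : comNzRingType) (I : set T) : set (set T) :=
  [set p | prime_ideal p /\ exists f : T, p = [set g | I (g * f)]].

(* The local ring T_p of a domain T, as a subring of the fraction field. *)
Definition localization (T : idomainType) (p : set T) : set {fraction T} :=
  [set u | exists a s : T, ~ p s /\ u = tofrac a / tofrac s].

(* The extension I T_p, as a subset of the fraction field. *)
Definition local_extension (T : idomainType) (I p : set T) :
    set {fraction T} :=
  lin_span (localization p) (@tofrac T @` I).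

Definition symbolic_power (T : idomainType) (I : set T) (m : nat) : set T :=
  \bigcap_(p in associated_primes I)
    (@tofrac T @^-1` local_extension (ideal_pow I m) p).

(* G lists a set of homogeneous generators of J that is minimal for
   inclusion. *)
Definition minimal_homogeneous_generators (K : fieldType) (n : nat)
    (J : set {mpoly K[n]}) (G : seq {mpoly K[n]}) : Prop :=
  [/\ forall g, g \in G -> exists d : nat, g \is d.-homog,
      ideal_gen [set` G] = J
    & forall H : set {mpoly K[n]},
        H `<` [set` G] -> ideal_gen H <> J].

(* (msize g).-1 is the degree of g. For an ideal J the maximum is the same for all
   such lists of generators; it is 0 by convention if there are none. *)
Definition omega (K : fieldType) (n : nat) (J : set {mpoly K[n]}) : nat :=
  \max_(g <- xget [::] (minimal_homogeneous_generators J)) (msize g).-1.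

Definition fermat_ideal (K : fieldType) (n : nat) : set {mpoly K[3]} :=
  let x : {mpoly K[3]} := 'X_(@Ordinal 3 0 isT) in
  let y : {mpoly K[3]} := 'X_(@Ordinal 3 1 isT) in
  let z : {mpoly K[3]} := 'X_(@Ordinal 3 2 isT) in
  ideal_gen [set x * (y ^+ n - z ^+ n);
                 y * (z ^+ n - x ^+ n);
                 z * (x ^+ n - y ^+ n)].

Arguments fermat_ideal K n : clear implicits.

(* Main.v *)
Require Import Defs.
From mathcomp Require Import all_boot all_order all_algebra.
From mathcomp Require Import reals complex mpoly.
From mathcomp Require Import boolp classical_sets.
From mathcomp Require Import ring_quotient fraction ring lra zify.
From mathcomp Require Import cyclic separable cyclotomic.

(* Put u = y^n - z^n, v = z^n - x^n, w = x^n - y^n.  The base locus of I consists of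
   the n^2 points with x^n = y^n = z^n and the three coordinate points, and I^(m) is
   the ideal of polynomials vanishing there to order at least m.

   It is generated by the products x^i y^j z^k u^al v^be w^ga it contains.  Averaging
   over the diagonal matrices with entries of equal n-th power reduces this to
   x^r0 y^r1 z^r2 F(x^n, y^n, z^n) with F homogeneous of degree d, of orders m at
   (1:1:1) and a/n, b/n, c/n at the coordinate points.  If nd < nm + a, then F
   vanishes on the line y = z by Bezout and is divisible by it; otherwise
   some combination of products agrees with F on the line x = 0, and the difference
   is divisible by x.  Either way the degree drops.

   Using u + v + w = 0 and u = y^n - z^n, the products of degree more than m(n+1) are
   redundant.  Conversely, an element of I^(m) of degree less than m(n+1) vanishes
   on the line y = z, which contains n+1 of the points, but (yv)^m does not. *)

Set Implicit Arguments.
Unset Strict Implicit.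
Unset Printing Implicit Defensive.

Import Order.TTheory GRing.Theory Num.Theory.
Local Open Scope classical_set_scope.
Local Open Scope ring_scope.

(** * Ideals, prime ideals and symbolic powers *)

(** The identification of I^(m) with the polynomials vanishing to order m comes out of a circle of
    inclusions. Elements of I^(m) vanish to order m along formal arcs, because each Fermat point
    yields an explicit associated prime; vanishing polynomials are combinations of products;
    products lie in I^(m). The last inclusion must hold at every associated prime p, and the
    obstacle is a possible embedded component at (x, y, z). It is excluded by the case m = 1 of the
    middle inclusion, where the products of degree at most n+1 are visibly multiples of the
    generators of I. A prime p containing I but not all of x, y, z contains none or exactly two of
    them, and these cases settle the local computation. Arcs have coefficients in the polynomial
    ring, so that one arc with indeterminate direction measures a multiplicity. Roots of unity serve
    twice: to separate exponents modulo n, and to supply points on the line y = z. *)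

Section Ideals.
Variable T : comNzRingType.
Implicit Types (S : set T) (f g : T).

Lemma ideal_gen0 S : ideal_gen S 0.
Proof.
exists 0%N, (fun _ => 0), (fun _ => 0); split=> [i|[]//|] //.
by rewrite big_ord0.
Qed.

Lemma ideal_genD S f g : ideal_gen S f -> ideal_gen S g -> ideal_gen S (f + g).
Proof.
move=> [k1 [a1 [g1 [_ g1S ->]]]] [k2 [a2 [g2 [_ g2S ->]]]].
exists (k1 + k2)%N,
  (fun i => match split i with inl j => a1 j | inr j => a2 j end),
  (fun i => match split i with inl j => g1 j | inr j => g2 j end).
split=> // [i|]; first by case: (split i).
rewrite big_split_ord /=; congr (_ + _); apply: eq_bigr => i _.
- by rewrite (unsplitK (inl i)).
- by rewrite (unsplitK (inr i)).
Qed.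

Lemma ideal_genMl S h f : ideal_gen S f -> ideal_gen S (h * f).
Proof.
move=> [k [a [g [_ gS ->]]]]; exists k, (fun i => h * a i), g.
by split=> //; rewrite mulr_sumr; apply: eq_bigr => i _; rewrite mulrA.
Qed.

Lemma ideal_genMr S h f : ideal_gen S f -> ideal_gen S (f * h).
Proof. by rewrite mulrC; apply: ideal_genMl. Qed.

Lemma ideal_genN S f : ideal_gen S f -> ideal_gen S (- f).
Proof. by rewrite -mulN1r; apply: ideal_genMl. Qed.

Lemma ideal_genB S f g : ideal_gen S f -> ideal_gen S g -> ideal_gen S (f - g).
Proof. by move=> Sf Sg; apply/ideal_genD/ideal_genN. Qed.

Lemma mem_ideal_gen S f : S f -> ideal_gen S f.
Proof.
move=> Sf; exists 1%N, (fun _ => 1), (fun _ => f).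
by split=> //; rewrite big_ord1 mul1r.
Qed.

Lemma ideal_gen_sum S (J : Type) (r : seq J) (P : pred J) (F : J -> T) :
  (forall j, P j -> ideal_gen S (F j)) -> ideal_gen S (\sum_(j <- r | P j) F j).
Proof.
move=> SF; elim/big_ind: _ => //; [exact: ideal_gen0|exact: ideal_genD].
Qed.

Lemma ideal_gen_min S (J : set T) :
  J 0 -> (forall f g, J f -> J g -> J (f + g)) ->
  (forall h f, J f -> J (h * f)) -> S `<=` J -> ideal_gen S `<=` J.
Proof.
move=> J0 JD JM SJ f [k [a [g [_ gS ->]]]].
by elim/big_ind: _ => // i _; apply/JM/SJ.
Qed.

Lemma ideal_gen_sub S S' : S `<=` ideal_gen S' -> ideal_gen S `<=` ideal_gen S'.
Proof.
apply: ideal_gen_min; [exact: ideal_gen0|exact: ideal_genD|exact: ideal_genMl].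
Qed.

Lemma ideal_gen_mul S S' h f :
  (forall g, S g -> ideal_gen S' (h * g)) -> ideal_gen S f -> ideal_gen S' (h * f).
Proof.
move=> SS'; apply: (@ideal_gen_min S [set f | ideal_gen S' (h * f)]) => //=.
- by rewrite mulr0; apply: ideal_gen0.
- by move=> f1 f2 *; rewrite mulrDr; apply: ideal_genD.
- by move=> h1 f1 *; rewrite mulrCA; apply: ideal_genMl.
Qed.

Lemma ideal_pow0 (I : set T) f : ideal_pow I 0 f.
Proof.
rewrite -[f]mulr1; apply/ideal_genMl/mem_ideal_gen.
by exists (fun _ => 0) => [[]|] //; rewrite big_ord0.
Qed.

Lemma ideal_powS (I : set T) m f g :
  I f -> ideal_pow I m g -> ideal_pow I m.+1 (f * g).
Proof.
move=> If; apply: ideal_gen_mul => _ [F FI ->]; apply: mem_ideal_gen.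
exists (fun i => if unlift ord0 i is Some j then F j else f).
  by move=> i; case: unliftP.
rewrite big_ord_recl unlift_none; congr (_ * _).
by apply: eq_bigr => i _; rewrite liftK.
Qed.

Lemma ideal_powM (I : set T) k m f g :
  ideal_pow I k f -> ideal_pow I m g -> ideal_pow I (k + m) (f * g).
Proof.
move=> If Ig; rewrite mulrC; apply: ideal_gen_mul If => _ [F FI ->]; rewrite mulrC.
elim: k F FI => [|k IH] F FI; first by rewrite big_ord0 mul1r.
by rewrite big_ord_recl -mulrA addSn; apply: ideal_powS (FI _) (IH _ _) => i.
Qed.

Lemma ideal_powX (I : set T) k m f : ideal_pow I k f -> ideal_pow I (k * m) (f ^+ m).
Proof.
move=> If; elim: m => [|m IH]; first by rewrite muln0; apply: ideal_pow0.
by rewrite exprS mulnS; apply: ideal_powM.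
Qed.

Lemma ideal_pow1 (I : set T) f : I f -> ideal_pow I 1 f.
Proof. by move=> If; rewrite -[f]mulr1; apply: ideal_powS => //; apply: ideal_pow0. Qed.

Lemma ideal_pow_leq (I : set T) m k f : (k <= m)%N -> ideal_pow I m f -> ideal_pow I k
  f.
Proof.
move=> le_km; apply: ideal_gen_sub => _ [F FI ->].
move: F FI; rewrite -(subnKC le_km) => F FI.
rewrite big_split_ord /=; apply/ideal_genMr/mem_ideal_gen.
by exists (fun i => F (lshift _ i)).
Qed.

End Ideals.

Lemma prime_ideal_prod (T : comNzRingType) (p : set T) (J : Type) (r : seq J)
    (P : pred J) (F : J -> T) :
  prime_ideal p -> (forall j, P j -> ~ p (F j)) -> ~ p (\prod_(j <- r | P j) F j).
Proof.
move=> [[p0 p1 _] pp] pF; elim/big_ind: _ => //.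
- by move=> p1'; move/negP: p1; rewrite inE.
- move=> f g nf ng /mem_set /pp /orP[] /set_mem; [exact: nf|exact: ng].
Qed.

Lemma prime_idealM (T : comNzRingType) (p : set T) f g :
  prime_ideal p -> p (f * g) -> p f \/ p g.
Proof.
by move=> [_ pp] /mem_set /pp /orP[] /set_mem; [left|right].
Qed.

Lemma prime_ideal_add (T : comNzRingType) (p : set T) f g :
  prime_ideal p -> p f -> p g -> p (f + g).
Proof.
move=> [[_ _ pD] _] pf pg; apply/set_mem; rewrite -[f]mul1r.
by apply: pD; apply: mem_set.
Qed.

Lemma prime_ideal_mul (T : comNzRingType) (p : set T) h f :
  prime_ideal p -> p f -> p (h * f).
Proof.
move=> [[p0 _ pD] _] pf; apply/set_mem; rewrite -[h * f]addr0.
by apply: pD; first apply: mem_set.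
Qed.

Lemma prime_idealX (T : comNzRingType) (p : set T) f k :
  prime_ideal p -> p (f ^+ k) -> p f.
Proof.
move=> pp; elim: k => [|k IH]; last first.
  by rewrite exprS => /(prime_idealM pp) [|/IH].
by case: pp => [[_ /negP p1 _] _] /mem_set.
Qed.

(** The complement of a prime is closed under products, so the denominators of a finite combination
    over the local ring are cleared all at once. From here on the fraction field disappears. *)
Lemma symbolic_powerP (T : idomainType) (I : set T) m f :
  symbolic_power I m f <->
  forall p, associated_primes I p -> exists2 s, ~ p s & ideal_pow I m (s * f).
Proof.
split=> [If p Ip|If p Ip /=]; last first.
  have [s ps Isf] := If p Ip.
  have s0 : s != 0.
    apply/eqP => s0; apply: ps; rewrite s0; apply/set_mem.
    by case: Ip => [[[]]].
  exists 1%N, (fun _ => tofrac 1 / tofrac s), (fun _ => tofrac (s * f)).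
  split=> [_|_|]; [by exists 1, s|by exists (s * f)|].
  by rewrite big_ord1 tofrac1 div1r tofracM mulKf ?tofrac_eq0.
have [pp _] := Ip.
have /= [k [a [g [aL gI fE]]]] := If p Ip.
have {}aL i : exists bs : T * T, ~ p bs.2 /\ a i = tofrac bs.1 / tofrac bs.2.
  by have [b [s ?]] := aL i; exists (b, s).
have [bs bsP] := choice aL.
have {}gI i : exists h, ideal_pow I m h /\ tofrac h = g i.
  by have [h hI <-] := gI i; exists h.
have [h hP] := choice gI.
exists (\prod_i (bs i).2); first by apply: prime_ideal_prod => // i _; case: (bsP i).
suff -> : (\prod_i (bs i).2) * f =
    \sum_i (\prod_(j | j != i) (bs j).2) * (bs i).1 * h i.
  by apply: ideal_gen_sum => i _; apply: ideal_genMl; case: (hP i).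
apply/eqP; rewrite -tofrac_eq tofracM fE rmorph_sum mulr_sumr /=.
apply/eqP/eq_bigr => i _; have [psi ->] := bsP i; have [_ <-] := hP i.
rewrite (bigD1 i) //= !tofracM.
have s0 : tofrac (bs i).2 != 0 :> {fraction T}.
  rewrite tofrac_eq0; apply/eqP => s0; apply: psi; rewrite s0; apply/set_mem.
  by case: pp => [[]].
by field.
Qed.

Lemma symbolic_powerD (T : idomainType) (I : set T) m f g :
  symbolic_power I m f -> symbolic_power I m g -> symbolic_power I m (f + g).
Proof.
move=> /symbolic_powerP If /symbolic_powerP Ig; apply/symbolic_powerP => p Ip.
have [s ps sf] := If p Ip; have [t pt tg] := Ig p Ip.
exists (s * t); first by case: Ip => pp _ /(prime_idealM pp) [].
by rewrite mulrDr; apply: ideal_genD; [rewrite mulrAC mulrC|rewrite -mulrA];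
  apply: ideal_genMl.
Qed.

Lemma symbolic_powerMl (T : idomainType) (I : set T) m h f :
  symbolic_power I m f -> symbolic_power I m (h * f).
Proof.
move=> /symbolic_powerP If; apply/symbolic_powerP => p Ip.
by have [s ps sf] := If p Ip; exists s => //; rewrite mulrCA; apply: ideal_genMl.
Qed.

Lemma symbolic_power0 (T : idomainType) (I : set T) m : symbolic_power I m 0.
Proof.
apply/symbolic_powerP => p [[[_ /negP p1 _] _] _]; exists 1; last first.
  by rewrite mulr0; apply: ideal_gen0.
by move=> /mem_set.
Qed.

(** * Minimal homogeneous generators *)

Section Homogeneous.
Variables (K : fieldType) (N : nat).
Implicit Types (p q f g : {mpoly K[N]}) (G : seq {mpoly K[N]}).

Lemma pihomogM d e p g : g \is d.-homog ->
  pihomog mdeg e (p * g) = if (d <= e)%N then pihomog mdeg (e - d) p * g else 0.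
Proof.
move=> gd; have pE := pihomog_partitionE (leqnn (msize p)).
rewrite [in LHS]pE mulr_suml raddf_sum /=.
have hom i : pihomog mdeg i p * g \is (i + d).-homog.
  by apply: dhomogM => //; apply: pihomogP.
case: ifP => [le_de|lt_ed]; last first.
  rewrite big1 // => i _; apply: pihomog_ne0 (hom i).
  by apply/eqP => ide; move: lt_ed; rewrite -ide leq_addl.
have [lt_s|ge_s] := ltnP (e - d) (msize p).
  rewrite (bigD1 (Ordinal lt_s)) //= big1 ?addr0 => [|i ne_i].
    by have := hom (Ordinal lt_s); rewrite /= subnK // => /pihomog_dE.
  apply: pihomog_ne0 (hom i).
  by apply: contraNneq ne_i => ide; rewrite -val_eqE /= -ide addnK.
rewrite big1 => [|i _].
  have := @pihomog_partitionE _ _ mdeg (e - d).+1 p (leqW ge_s).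
  rewrite big_ord_recr /= -(@pihomog_partitionE _ _ mdeg (e - d) p ge_s).
  by move/eqP; rewrite -[X in X == _]addr0 (inj_eq (addrI _)) => /eqP <-; rewrite mul0r.
apply: pihomog_ne0 (hom i); apply: contraTneq (ltn_ord i) => ide.
by rewrite -ltnNge ltnS; move: ge_s; rewrite -ide addnK.
Qed.

Lemma dhomog_mul_cancel d k p q : p != 0 -> q != 0 ->
  p \is k.-homog -> q * p \is d.-homog -> (k <= d)%N /\ q \is (d - k).-homog.
Proof.
move=> p0 q0 pk /pihomog_dE; rewrite (pihomogM d q pk).
case: ifP => _ /eqP; last by rewrite eq_sym mulf_eq0 (negPf p0) (negPf q0).
by rewrite (inj_eq (mulIf p0)) -homog_piE.
Qed.

(** A generating list of least length among those drawn from [G] works: a proper generating subset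
    of it would be listed by a shorter one. *)
Lemma exists_minimal_homogeneous_generators G :
  (forall g, g \in G -> exists d, g \is d.-homog) ->
  exists G', minimal_homogeneous_generators (ideal_gen [set` G]) G'.
Proof.
move=> Ghom.
pose P k := `[< exists G', [/\ size G' = k, {subset G' <= G}
                            & ideal_gen [set` G'] = ideal_gen [set` G]] >].
have exP : exists k, P k by exists (size G); apply/asboolP; exists G; split.
case: (ex_minnP exP) => k /asboolP [G' [sG' G'G G'J]] kmin.
exists G'; split=> // [g /G'G /Ghom //|H [HG' G'H] HJ].
pose G1 := [seq g <- G' | `[< H g >]].
have G1H : [set` G1] = H.
  apply/seteqP; split=> g /=; rewrite mem_filter; first by case/andP=> /asboolP.
  by move=> Hg; rewrite (HG' g Hg) andbT; apply/asboolP.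
have : (k <= size G1)%N.
  apply: kmin; apply/asboolP; exists G1; split=> //; last by rewrite G1H.
  by move=> g; rewrite mem_filter => /andP[_ /G'G].
rewrite -sG' leqNgt size_filter -(count_predC (fun g => `[< H g >])) -addn1.
rewrite leq_add2l -has_count => /negP; apply; apply/hasP.
apply: contrapT => noG; apply: G'H => g gG'; apply: contrapT => nHg.
by apply: noG; exists g => //=; apply/asboolPn.
Qed.

(** Take the component of degree d <= b in an expression of an element of [S] over [G]: only
    generators of degree at most b contribute. One of larger degree could be dropped, against
    minimality. *)
Lemma minimal_generator_degree_le J (S : set {mpoly K[N]}) b G :
  J = ideal_gen S ->
  (forall g, S g -> exists2 d, (d <= b)%N & g \is d.-homog) ->
  minimal_homogeneous_generators J G ->
  forall g, g \in G -> ((msize g).-1 <= b)%N.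
Proof.
move=> JS Shom [Ghom GJ Gmin] g gG; rewrite leqNgt; apply/negP => gb.
have [dg gdg] := Ghom g gG.
apply: (Gmin [set g' | g' \in G /\ g' <> g]).
  split=> [g' [] //|/(_ g)]; rewrite /= gG => /(_ isT) [_]; exact.
apply/seteqP; split.
  by rewrite -GJ; apply: ideal_gen_sub => g' [g'G _]; apply: mem_ideal_gen.
rewrite JS; apply: ideal_gen_sub => f Sf; have [d db fd] := Shom f Sf.
have : ideal_gen [set` G] f by rewrite GJ JS; apply: mem_ideal_gen.
move=> [k [a [h [_ hG fE]]]].
rewrite -(pihomog_dE fd) fE raddf_sum /=; apply: ideal_gen_sum => i _.
have [di hdi] := Ghom _ (hG i); rewrite (pihomogM _ _ hdi).
case: ifP => [di_d|_]; last exact: ideal_gen0.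
apply/ideal_genMl/mem_ideal_gen; split=> [|hg]; first exact: hG.
have := dhomog_msize hdi; rewrite hg => hom.
(* Zero has [msize] 0, so a generator of degree above b is nonzero and its degree of homogeneity is
   unique. *)
have h0 : h i != 0 by apply: contraTneq gb => h0; rewrite -hg h0 msize0.
have := dhomog_uniq h0 hdi; rewrite hg => /(_ _ hom) dib.
by move: gb; rewrite ltnNge -dib (leq_trans di_d).
Qed.

End Homogeneous.

(** * Products of x, y, z and u, v, w *)

(** The ring is arbitrary because products are evaluated along arcs. The value n = 1 gives the forms
    F that become products after substitution of n-th powers. *)
Definition fermat_prod (T : comNzRingType) (n : nat) (x y z : T)
    (i j k al be ga : nat) : T :=
  x ^+ i * y ^+ j * z ^+ k *
  (y ^+ n - z ^+ n) ^+ al * (z ^+ n - x ^+ n) ^+ be * (x ^+ n - y ^+ n) ^+ ga.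

Arguments fermat_prod : simpl never.

(** These are orders of vanishing. At the n^2 general points u, v, w have order 1 and x, y, z order
    0; at (1:0:0) the form u has order n, y and z have order 1, and the rest are units; likewise for
    b at (0:1:0) and c at (0:0:1). *)
Definition fat_exponents (n m a b c i j k al be ga : nat) : bool :=
  [&& m <= al + be + ga, a <= n * al + j + k, b <= n * be + i + k
    & c <= n * ga + i + j]%N.

(** * Exponents of products of degree more than m(n+1) *)

Section ReductionCases.
Local Open Scope nat_scope.
Variables (n m i j k al be ga : nat).
Hypotheses (n_ge3 : 3 <= n) (m_gt0 : 1 <= m).
Hypothesis fat : fat_exponents n m m m m i j k al be ga.

(** Otherwise n al, n be and n ga are each at most m, with sum at most 3m <= nm, although al + be +
    ga > m makes that sum at least nm + n. *)
Lemma reduction_large_order : m < al + be + ga ->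
  [\/ (0 < al) && (m < n * al + j + k), (0 < be) && (m < n * be + i + k)
    | (0 < ga) && (m < n * ga + i + j)].
Proof.
case/and4P: fat => _ ma mb mc gt.
have sM : n * m + n <= n * al + n * be + n * ga.
  by rewrite -!mulnDr addnC -mulnS leq_mul2l gt orbT.
have nm : 3 * m <= n * m by rewrite leq_mul2r n_ge3 orbT.
have z al' : al' = 0 -> n * al' = 0 by move->; rewrite muln0.
have [a|na] := boolP ((0 < al) && _); first by constructor 1.
have [b|nb] := boolP ((0 < be) && _); first by constructor 2.
have [c|nc] := boolP ((0 < ga) && _); first by constructor 3.
move: ma mb mc sM nm na nb nc (z al) (z be) (z ga); clear z fat.
move: (n * al) (n * be) (n * ga) (n * m) => A B C M *.
by exfalso; lia.
Qed.

Let pair_tight p q a b c ga' :=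
  [&& 0 < p, 0 < q, a == m, b == m, 0 < ga' & m + n + 1 <= c].

(** Here i + j + k > m, and the orders a, b, c at the coordinate points satisfy a + b + c = nm + 2(i
    + j + k), so they cannot all equal m. If a = m then j + k <= m, hence i > 0; so when a alone
    equals m, one can divide by x. If a = b = m, then c >= nm + 2 >= m + n + 1, the last step being
    (n-1)(m-1) >= 0. *)
Lemma reduction_large_degree : al + be + ga <= m ->
  m * (n + 1) < i + j + k + n * (al + be + ga) ->
  [\/ [|| [&& 0 < i, m < n * be + i + k & m < n * ga + i + j],
          [&& 0 < j, m < n * al + j + k & m < n * ga + i + j]
        | [&& 0 < k, m < n * al + j + k & m < n * be + i + k]],
     pair_tight i j (n * al + j + k) (n * be + i + k) (n * ga + i + j) ga,
     pair_tight i k (n * al + j + k) (n * ga + i + j) (n * be + i + k) be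
   | pair_tight j k (n * be + i + k) (n * ga + i + j) (n * al + j + k) al].
Proof.
case/and4P: fat => ms ma mb mc le; rewrite mulnDr muln1 (mulnC m n).
have sE : al + be + ga = m by apply/eqP; rewrite eqn_leq le ms.
have sM : n * al + n * be + n * ga = n * m by rewrite -sE !mulnDr.
have nm : 3 * m <= n * m by rewrite leq_mul2r n_ge3 orbT.
have nm1 : n + m <= n * m + 1 by clear -n_ge3 m_gt0; nia.
have z al' : al' = 0 -> n * al' = 0 by move->; rewrite muln0.
rewrite sE -sM; move: ma mb mc nm nm1 (z al) (z be) (z ga); rewrite -sM /pair_tight.
clear z fat sM.
move: (n * al) (n * be) (n * ga) => A B C ma mb mc nm nm1 zA zB zC hi.
clear le ms sE; rewrite !eqn_leq ma mb mc !andbT !(leqNgt _ m).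
have [i0|i0] := posnP i; have [j0|j0] := posnP j; have [k0|k0] := posnP k;
have [at_|at_] := ltnP m (A + j + k); have [bt|bt] := ltnP m (B + i + k);
have [ct|ct] := ltnP m (C + i + j); rewrite /= ?orbT;
  first [by constructor 1 | by exfalso; lia | by constructor 2; lia
        | by constructor 3; lia | by constructor 4; lia].
Qed.

End ReductionCases.

Section Reduction.
Local Open Scope nat_scope.
Variables (n m : nat) (Q : nat -> nat -> nat -> nat -> nat -> nat -> Prop).
Hypotheses (n_ge3 : 3 <= n) (m_gt0 : 1 <= m).

Let valid := fat_exponents n m m m m.
Let deg i j k al be ga := i + j + k + n * (al + be + ga).

Hypothesis Qlow : forall i j k al be ga, valid i j k al be ga ->
  deg i j k al be ga <= m * (n + 1) -> Q i j k al be ga.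
Hypothesis Qx : forall i j k al be ga, Q i j k al be ga -> Q i.+1 j k al be ga.
Hypothesis Qy : forall i j k al be ga, Q i j k al be ga -> Q i j.+1 k al be ga.
Hypothesis Qz : forall i j k al be ga, Q i j k al be ga -> Q i j k.+1 al be ga.
Hypothesis Qu : forall i j k al be ga,
  Q i j k al be.+1 ga -> Q i j k al be ga.+1 -> Q i j k al.+1 be ga.
Hypothesis Qv : forall i j k al be ga,
  Q i j k al.+1 be ga -> Q i j k al be ga.+1 -> Q i j k al be.+1 ga.
Hypothesis Qw : forall i j k al be ga,
  Q i j k al.+1 be ga -> Q i j k al be.+1 ga -> Q i j k al be ga.+1.
Hypothesis Qyz : forall i j k al be ga,
  Q i (j + n) k al be ga -> Q i j (k + n) al be ga -> Q i j k al.+1 be ga.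
Hypothesis Qzx : forall i j k al be ga,
  Q i j (k + n) al be ga -> Q (i + n) j k al be ga -> Q i j k al be.+1 ga.
Hypothesis Qxy : forall i j k al be ga,
  Q (i + n) j k al be ga -> Q i (j + n) k al be ga -> Q i j k al be ga.+1.

(* With a, b, c the three multiplicities at the coordinate points: if the number
   of factors u, v, w exceeds m, then some factor, say u, occurs with a > m, and
   y^n - z^n = u lets one divide by y or z.  If that number is m and the degree
   exceeds m(n+1), then either one of x, y, z can be divided out, or two of
   a, b, c, say a and b, equal m; then c is large and w = -(u + v) applies. *)
Lemma fat_exponents_reduction i j k al be ga :
  valid i j k al be ga -> Q i j k al be ga.
Proof.
have [D] := ubnP (deg i j k al be ga).
elim: D i j k al be ga => // D IH i j k al be ga; rewrite ltnS => leD vld.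
have {}IH i' j' k' al' be' ga' : deg i' j' k' al' be' ga' < deg i j k al be ga ->
    valid i' j' k' al' be' ga' -> Q i' j' k' al' be' ga'.
  by move=> lt; apply: IH; apply: leq_trans lt leD.
have [|hi] := leqP (deg i j k al be ga) (m * (n + 1)); first exact: Qlow.
have n1 : n = n.-1.+1 by lia.
have [gt|le] := ltnP m (al + be + ga).
  have := reduction_large_order n_ge3 m_gt0 vld gt.
  move: IH; case/and4P: vld => _ ma mb mc; rewrite {leD hi}/deg => IH.
  case=> /andP[+ at_].
  (* Replacing u by y^n or z^n keeps the order at (1:0:0), where the slack then pays for dividing by
     one y or z. The excess of al + be + ga over m pays for the loss at the general points. *)
  - case: al IH gt ma at_ => // al' IH; rewrite !mulnS => gt ma at_ _.
    by apply: Qyz; rewrite n1 addnS;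
      [apply: Qy|apply: Qz]; (apply: IH; [|apply/and4P; split]); lia.
  - case: be IH gt mb at_ => // be' IH; rewrite !mulnS => gt mb at_ _.
    by apply: Qzx; rewrite n1 addnS;
      [apply: Qz|apply: Qx]; (apply: IH; [|apply/and4P; split]); lia.
  - case: ga IH gt mc at_ => // ga' IH; rewrite !mulnS => gt mc at_ _.
    by apply: Qxy; rewrite n1 addnS;
      [apply: Qx|apply: Qy]; (apply: IH; [|apply/and4P; split]); lia.
have := reduction_large_degree n_ge3 m_gt0 vld le hi.
move: IH; case/and4P: vld => ms ma mb mc; rewrite {leD hi}/deg => IH {le n1}.
case=> [/or3P[] /and3P[+ h1 h2]|||].
- case: i IH mb mc h1 h2 => // i' IH mb mc h1 h2 _.
  by apply: Qx; (apply: IH; [|apply/and4P; split]); lia.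
- case: j IH ma mc h1 h2 => // j' IH ma mc h1 h2 _.
  by apply: Qy; (apply: IH; [|apply/and4P; split]); lia.
- case: k IH ma mb h1 h2 => // k' IH ma mb h1 h2 _.
  by apply: Qz; (apply: IH; [|apply/and4P; split]); lia.
(* Trading w for u costs n at (0:0:1) and gains n at (1:0:0); dividing by y then costs 1 at both.
   The margin m + n + 1 covers this; trading w for v and dividing by x is symmetric. *)
- move=> /and5P[i0 j0 /eqP at_ /eqP bt /andP[c0 ct]].
  rewrite -(prednK c0) in IH ms mc ct *; rewrite !mulnS in mc ct.
  apply: Qw; [rewrite -(prednK j0); apply: Qy|rewrite -(prednK i0); apply: Qx];
    by (apply: IH; [|apply/and4P; split]); lia.
- move=> /and5P[i0 j0 /eqP at_ /eqP bt /andP[c0 ct]].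
  rewrite -(prednK c0) in IH ms mb ct *; rewrite !mulnS in mb ct.
  apply: Qv; [rewrite -(prednK j0); apply: Qz|rewrite -(prednK i0); apply: Qx];
    by (apply: IH; [|apply/and4P; split]); lia.
- move=> /and5P[i0 j0 /eqP at_ /eqP bt /andP[c0 ct]].
  rewrite -(prednK c0) in IH ms ma ct *; rewrite !mulnS in ma ct.
  apply: Qu; [rewrite -(prednK j0); apply: Qz|rewrite -(prednK i0); apply: Qy];
    by (apply: IH; [|apply/and4P; split]); lia.
Qed.

End Reduction.

Section FatProducts.
Variables (T : comNzRingType) (n : nat) (x y z : T).

Local Notation prod := (fermat_prod n x y z).

Lemma fermat_prodx i j k al be ga : prod i.+1 j k al be ga = x * prod i j k al be ga.
Proof. by rewrite /fermat_prod exprS !mulrA. Qed.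

Lemma fermat_prody i j k al be ga : prod i j.+1 k al be ga = y * prod i j k al be ga.
Proof. by rewrite /fermat_prod exprS mulrCA !mulrA. Qed.

Lemma fermat_prodz i j k al be ga : prod i j k.+1 al be ga = z * prod i j k al be ga.
Proof. by rewrite /fermat_prod exprS; ring. Qed.

Lemma fermat_produ i j k al be ga :
  prod i j k al.+1 be ga = (y ^+ n - z ^+ n) * prod i j k al be ga.
Proof. by rewrite /fermat_prod exprS; ring. Qed.

Lemma fermat_prodv i j k al be ga :
  prod i j k al be.+1 ga = (z ^+ n - x ^+ n) * prod i j k al be ga.
Proof. by rewrite /fermat_prod exprS; ring. Qed.

Lemma fermat_prodw i j k al be ga :
  prod i j k al be ga.+1 = (x ^+ n - y ^+ n) * prod i j k al be ga.
Proof. by rewrite /fermat_prod exprS; ring. Qed.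

Lemma fermat_prodXn p q r i j k al be ga :
  prod (p + i) (q + j) (r + k) al be ga = x ^+ p * y ^+ q * z ^+ r * prod i j k al be
    ga.
Proof. by rewrite /fermat_prod !exprD; ring. Qed.

Definition fat_products (m a b c : nat) : set T :=
  [set f | exists i j k al be ga,
     fat_exponents n m a b c i j k al be ga /\ f = prod i j k al be ga].

Definition low_fat_products (m : nat) : set T :=
  [set f | exists i j k al be ga,
     [/\ fat_exponents n m m m m i j k al be ga,
         (i + j + k + n * (al + be + ga) <= m * (n + 1))%N
       & f = prod i j k al be ga]].

Lemma fat_products_low (m : nat) : (3 <= n)%N -> (1 <= m)%N ->
  ideal_gen (fat_products m m m m) `<=` ideal_gen (low_fat_products m).
Proof.
move=> n3 m1; apply: ideal_gen_sub => _ [i [j [k [al [be [ga [vld ->]]]]]]].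
move: vld; apply: (@fat_exponents_reduction _ _
  (fun i j k al be ga => ideal_gen (low_fat_products m) (prod i j k al be ga))) => //;
  move=> {i j k al be ga} i j k al be ga.
- move=> vld le; apply: mem_ideal_gen.
  by exists i, j, k, al, be, ga; split.
- by rewrite fermat_prodx; apply: ideal_genMl.
- by rewrite fermat_prody; apply: ideal_genMl.
- by rewrite fermat_prodz; apply: ideal_genMl.
- rewrite fermat_produ fermat_prodv fermat_prodw => h1 h2.
  by have := ideal_genN (ideal_genD h1 h2); congr (ideal_gen _ _); ring.
- rewrite fermat_produ fermat_prodv fermat_prodw => h1 h2.
  by have := ideal_genN (ideal_genD h1 h2); congr (ideal_gen _ _); ring.
- rewrite fermat_produ fermat_prodv fermat_prodw => h1 h2.
  by have := ideal_genN (ideal_genD h1 h2); congr (ideal_gen _ _); ring.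
- rewrite fermat_produ => h1 h2.
  have := ideal_genB h1 h2; congr (ideal_gen _ _).
  by rewrite /fermat_prod !exprD; ring.
- rewrite fermat_prodv => h1 h2.
  have := ideal_genB h1 h2; congr (ideal_gen _ _).
  by rewrite /fermat_prod !exprD; ring.
- rewrite fermat_prodw => h1 h2.
  have := ideal_genB h1 h2; congr (ideal_gen _ _).
  by rewrite /fermat_prod !exprD; ring.
Qed.

End FatProducts.

Lemma rmorph_fermat_prod (T T' : comNzRingType) (phi : {rmorphism T -> T'})
    n x y z i j k al be ga :
  phi (fermat_prod n x y z i j k al be ga) =
  fermat_prod n (phi x) (phi y) (phi z) i j k al be ga.
Proof. by rewrite /fermat_prod !rmorphM /= !rmorphXn /= !rmorphB /= !rmorphXn. Qed.

(** * Orders of vanishing along arcs *)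

Section MPolyMorphisms.
Variables (K : fieldType) (N : nat).

Lemma mmap_X (T : comNzRingType) (f : {rmorphism K -> T}) (h : 'I_N -> T) i :
  mmap f h 'X_i = h i.
Proof. by rewrite mmapX mmap1U. Qed.

Lemma mpoly_rmorph_ext (T : comNzRingType) (phi psi : {rmorphism {mpoly K[N]} -> T}) :
  (forall c, phi c%:MP = psi c%:MP) -> (forall i, phi 'X_i = psi 'X_i) ->
  phi =1 psi.
Proof.
move=> eqC eqX p; rewrite [p]mpolyE !rmorph_sum; apply: eq_bigr => m _ /=.
rewrite -mul_mpolyC !rmorphM eqC mpolyXE_id !rmorph_prod; congr (_ * _).
by apply: eq_bigr => i _ /=; rewrite !rmorphXn /= eqX.
Qed.

(** The property passes to products by p1 p2 - p1(h) p2(h) = (p1 - p1(h)) p2 + p1(h) (p2 - p2(h)),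
    so constants and variables suffice. *)
Lemma sub_mmap_divides (h : 'I_N -> {mpoly K[N]}) (p : {mpoly K[N]}) :
  exists q : 'I_N -> {mpoly K[N]},
    p - mmap (@mpolyC N K) h p = \sum_i q i * ('X_i - h i).
Proof.
pose D (p : {mpoly K[N]}) := exists q : 'I_N -> {mpoly K[N]},
  p - mmap (@mpolyC N K) h p = \sum_i q i * ('X_i - h i).
have DC c : D c%:MP.
  exists (fun _ => 0); rewrite mmapC subrr big1 // => i _; exact: mul0r.
have DD p1 p2 : D p1 -> D p2 -> D (p1 + p2).
  move=> [q1 e1] [q2 e2]; exists (fun i => q1 i + q2 i).
  rewrite rmorphD opprD addrACA e1 e2 -big_split /=.
  by apply: eq_bigr => i _; rewrite mulrDl.
have DM p1 p2 : D p1 -> D p2 -> D (p1 * p2).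
  move=> [q1 e1] [q2 e2].
  exists (fun i => q1 i * p2 + mmap (@mpolyC N K) h p1 * q2 i).
  transitivity ((p1 - mmap (@mpolyC N K) h p1) * p2
     + mmap (@mpolyC N K) h p1 * (p2 - mmap (@mpolyC N K) h p2)).
    by rewrite rmorphM /=; ring.
  rewrite e1 e2 mulr_suml mulr_sumr -big_split /=.
  by apply: eq_bigr => i _; ring.
have DX i : D 'X_i.
  exists (fun j => (j == i)%:R); rewrite mmap_X (bigD1 i) //= eqxx mul1r.
  by rewrite big1 ?addr0 // => j /negPf->; rewrite mul0r.
rewrite -/(D p) [p]mpolyE; elim/big_ind: _ => //; first by rewrite -mpolyC0.
move=> m _; rewrite -mul_mpolyC; apply: (DM) => //; rewrite mpolyXE_id.
elim/big_ind: _ => [|p1 p2|i _]; [by rewrite -mpolyC1|exact: (DM)|].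
by elim: (m i) => [|k IH]; [rewrite expr0 -mpolyC1|rewrite exprS; apply: (DM)].
Qed.

End MPolyMorphisms.

Section OrderAtZero.
Variable S : idomainType.
Implicit Types p q : {poly S}.

Definition order_ge (m : nat) p := exists q, p = q * 'X^m.

Lemma order_ge0 p : order_ge 0 p.
Proof. by exists p; rewrite mulr1. Qed.

Lemma order_geD m p q : order_ge m p -> order_ge m q -> order_ge m (p + q).
Proof. by move=> [p1 ->] [q1 ->]; exists (p1 + q1); rewrite mulrDl. Qed.

Lemma order_ge_zero m : order_ge m 0.
Proof. by exists 0; rewrite mul0r. Qed.

Lemma order_geMl m p q : order_ge m p -> order_ge m (q * p).
Proof. by move=> [p1 ->]; exists (q * p1); rewrite mulrA. Qed.

Lemma order_geN m p : order_ge m p -> order_ge m (- p).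
Proof. by rewrite -mulN1r; apply: order_geMl. Qed.

Lemma order_geM m k p q : order_ge m p -> order_ge k q -> order_ge (m + k) (p * q).
Proof.
by move=> [p1 ->] [q1 ->]; exists (p1 * q1); rewrite exprD mulrACA.
Qed.

Lemma order_geX m k p : order_ge m p -> order_ge (m * k) (p ^+ k).
Proof.
move=> p_m; elim: k => [|k IH]; first by rewrite muln0; apply: order_ge0.
by rewrite exprS mulnS; apply: order_geM.
Qed.

Lemma order_ge_leq m k p : (k <= m)%N -> order_ge m p -> order_ge k p.
Proof.
by move=> /subnKC <- [q ->]; exists (q * 'X^(m - k)); rewrite exprD mulrCA mulrC.
Qed.

Lemma order_ge1 p : p`_0 = 0 -> order_ge 1 p.
Proof.
move=> p0; have /factor_theorem[q ->] : root p 0 by rewrite /root horner_coef0 p0.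
by exists q; rewrite subr0.
Qed.

Lemma order_ge_cancel m p q : q`_0 != 0 -> order_ge m (p * q) -> order_ge m p.
Proof.
move=> q0; elim: m p => [|m IH] p pq; first exact: order_ge0.
have [p1 p1E] : order_ge 1 p.
  apply: order_ge1; case: pq => r /(congr1 (fun p => p.[0])).
  rewrite !hornerM hornerXn expr0n mulr0 => /eqP.
  by rewrite mulf_eq0 !horner_coef0 (negPf q0) orbF => /eqP.
have [p2 p2E] : order_ge m p1.
  apply: IH; case: pq => r; rewrite p1E expr1 mulrAC exprS [RHS]mulrCA [RHS]mulrC.
  by move/(mulIf (monic_neq0 (monicX _))) => ->; exists r.
by exists p2; rewrite p1E p2E -mulrA -exprD addn1.
Qed.

Lemma order_ge_cancelX m k p q : q`_0 != 0 ->
  order_ge m (p * (q * 'X^k)) -> order_ge (m - k) p.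
Proof.
move=> q0; have [le_mk _|lt_km] := leqP m k.
  by move/eqP: le_mk => ->; apply: order_ge0.
move=> [r rE]; apply: (order_ge_cancel q0).
exists r; apply: (mulIf (monic_neq0 (monicXn _ k))).
by rewrite -!mulrA -exprD subnK ?(ltnW lt_km).
Qed.

Lemma order_ge_coef m p i : order_ge m p -> (i < m)%N -> p`_i = 0.
Proof. by move=> [q ->] im; rewrite coefMXn im. Qed.

Lemma order_ge_size m p : order_ge m p -> p != 0 -> (m < size p)%N.
Proof.
move=> [q ->] q0; have {}q0 : q != 0 by apply: contraNneq q0 => ->; rewrite mul0r.
by rewrite size_mulXn // -[X in (X < _)%N]addn0 ltn_add2l size_poly_gt0.
Qed.

End OrderAtZero.

Lemma order_ge_map (S S' : idomainType) (phi : {rmorphism S -> S'}) m (p : {poly S}) :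
  order_ge m p -> order_ge m (map_poly phi p).
Proof.
by move=> [q ->]; exists (map_poly phi q); rewrite rmorphM /= map_polyXn.
Qed.

Local Notation o0 := (@Ordinal 3 0 isT).
Local Notation o1 := (@Ordinal 3 1 isT).
Local Notation o2 := (@Ordinal 3 2 isT).

Lemma ord3P (P : 'I_3 -> Prop) : P o0 -> P o1 -> P o2 -> forall i, P i.
Proof.
move=> P0 P1 P2 [[|[|[|//]]] lt_i].
- by rewrite (_ : Ordinal lt_i = o0) //; apply: val_inj.
- by rewrite (_ : Ordinal lt_i = o1) //; apply: val_inj.
- by rewrite (_ : Ordinal lt_i = o2) //; apply: val_inj.
Qed.

(** * Fermat points, their prime ideals and the arcs through them *)

Section FermatPoints.
Variables (K : numFieldType) (n : nat).
Hypothesis n_gt0 : (0 < n)%N.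

Local Notation S := {mpoly K[3]}.
Local Notation I := (fermat_ideal K n).
Local Notation x := ('X_o0 : S).
Local Notation y := ('X_o1 : S).
Local Notation z := ('X_o2 : S).

Implicit Types (a : 'I_3 -> K) (h : 'I_3 -> {poly S}) (f : S).

Definition fermat_point (a : 'I_3 -> K) : Prop :=
  ((forall i, a i != 0) /\ (forall i j, a i ^+ n = a j ^+ n)) \/
  (exists2 j, a j != 0 & forall i, i != j -> a i = 0).

(** Restriction to the line spanned by the vector a. For a nonzero, its kernel is the homogeneous
    prime of the projective point a. *)
Definition ray a : {rmorphism S -> {poly K}} :=
  locked (mmap (@polyC K) (fun i => (a i)%:P * 'X) : {rmorphism S -> {poly K}}).

Definition arc_eval h : {rmorphism S -> {poly S}} :=
  locked (mmap (@polyC S \o @mpolyC 3 K) h : {rmorphism S -> {poly S}}).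

Lemma rayX a i : ray a 'X_i = (a i)%:P * 'X.
Proof. by rewrite /ray -lock; apply: mmap_X. Qed.

Lemma rayC a c : ray a c%:MP = c%:P.
Proof. by rewrite /ray -lock; apply: mmapC. Qed.

Lemma arc_evalX h i : arc_eval h 'X_i = h i.
Proof. by rewrite /arc_eval -lock; apply: mmap_X. Qed.

Lemma arc_evalC h c : arc_eval h c%:MP = c%:MP%:P.
Proof. by rewrite /arc_eval -lock; apply: mmapC. Qed.

(* h is a formal arc, with parameter 'X, starting at a generic point of the line
   spanned by a Fermat point. *)
Definition fermat_arc (h : 'I_3 -> {poly S}) : Prop :=
  exists a, exists2 j, fermat_point a & forall i, (h i)`_0 = (a i)%:MP * 'X_j.

(** Since arcs start at a generic point of the line, a polynomial outside the prime of the Fermat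
    point has nonzero constant coefficient along them. Such factors cancel from orders. *)
Definition vanishing_order_ge (m : nat) (f : S) : Prop :=
  forall h, fermat_arc h -> order_ge m (arc_eval h f).

Lemma fermat_point_neq0 a : fermat_point a -> exists j, a j != 0.
Proof. by case=> [[a0 _]|[j aj _]]; [exists o0|exists j]. Qed.

Lemma fermat_ideal_gens :
  [/\ I (x * (y ^+ n - z ^+ n)), I (y * (z ^+ n - x ^+ n))
    & I (z * (x ^+ n - y ^+ n))].
Proof.
split; apply: mem_ideal_gen; [by left; left|by left; right|by right].
Qed.

Lemma ray_fermat_ideal a f : fermat_point a -> I f -> ray a f = 0.
Proof.
move=> a_pt.
apply: (@ideal_gen_min _ _ [set f | ray a f = 0]) => /=.
- exact: rmorph0.
- by move=> f1 f2 e1 e2; rewrite rmorphD /= e1 e2 addr0.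
- by move=> h f1 e1; rewrite rmorphM /= e1 mulr0.
have n0 : n != 0%N by rewrite -lt0n.
have gen0 (i j k : 'I_3) : a i * (a j ^+ n - a k ^+ n) = 0 ->
    ray a ('X_i * ('X_j ^+ n - 'X_k ^+ n)) = 0.
  move=> e; rewrite rmorphM rmorphB !rmorphXn /= !rayX !exprMn -mulrBl mulrACA.
  by rewrite -!rmorphXn -rmorphB -rmorphM /= e mul0r.
have pt (i j k : 'I_3) : i != j -> j != k -> i != k -> a i * (a j ^+ n - a k ^+ n) = 0.
  move=> ij jk ik; case: a_pt => [[_ e]|[l al a0]];
    first by rewrite (e j k) subrr mulr0.
  have [il|il] := eqVneq i l; last by rewrite a0 ?mul0r.
  rewrite (a0 j) ?(a0 k) -?il ?[_ == i]eq_sym //.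
  by rewrite expr0n (negPf n0) subrr mulr0.
by move=> g [[]|] /= ->; apply/gen0/pt.
Qed.

Lemma ray_horner_neq0 a (j : 'I_3) f :
  ray a f != 0 -> (map_poly (@mpolyC 3 K) (ray a f)).['X_j] != 0.
Proof.
move=> af0; apply/eqP => e; case/eqP: af0.
have := congr1 (mmap (@polyC K) (fun _ : 'I_3 => 'X)) e.
rewrite -horner_map /= -map_poly_comp /= mmap_X rmorph0 => <-.
rewrite -[LHS]comp_polyXr /comp_poly; congr horner.
by apply: eq_map_poly => c /=; rewrite mmapC.
Qed.

Lemma arc_eval_coef0 h a (j : 'I_3) f : (forall i, (h i)`_0 = (a i)%:MP * 'X_j) ->
  (arc_eval h f)`_0 = (map_poly (@mpolyC 3 K) (ray a f)).['X_j].
Proof.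
move=> h0; rewrite -horner_coef0.
apply: (@mpoly_rmorph_ext _ _ _ (horner_eval 0 \o arc_eval h)
  (horner_eval 'X_j \o map_poly (@mpolyC 3 K) \o ray a)) => [c|i] /=.
  by rewrite arc_evalC rayC map_polyC /= /horner_eval !hornerC.
rewrite arc_evalX rayX rmorphM /= map_polyC /= map_polyX /horner_eval.
by rewrite hornerM hornerC hornerX horner_coef0 h0.
Qed.

Lemma arc_eval_coef0_neq0 h a (j : 'I_3) f :
  (forall i, (h i)`_0 = (a i)%:MP * 'X_j) -> ray a f != 0 -> (arc_eval h f)`_0 != 0.
Proof. by move=> h0; rewrite (arc_eval_coef0 _ h0); apply: ray_horner_neq0. Qed.

Lemma arc_eval_fermat_ideal h f : fermat_arc h -> I f -> order_ge 1 (arc_eval h f).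
Proof.
move=> [a [j a_pt h0]] If; apply: order_ge1.
by rewrite (arc_eval_coef0 _ h0) ray_fermat_ideal // rmorph0 horner0.
Qed.

Lemma arc_eval_fermat_ideal_pow h m f :
  fermat_arc h -> ideal_pow I m f -> order_ge m (arc_eval h f).
Proof.
move=> h_arc; apply: (@ideal_gen_min _ _ [set f | order_ge m (arc_eval h f)]) => /=.
- by rewrite rmorph0; apply: order_ge_zero.
- by move=> f1 f2 e1 e2; rewrite rmorphD; apply: order_geD e1 e2.
- by move=> h1 f1 e1; rewrite rmorphM; apply: order_geMl e1.
move=> _ [g gI ->] /=; rewrite rmorph_prod /=.
elim: m g gI => [|m IH] g gI; first exact: order_ge0.
rewrite big_ord_recl; apply: (@order_geM _ 1 m); first exact: arc_eval_fermat_ideal.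
by apply: IH.
Qed.

Lemma ray_ker_prime a : (exists j, a j != 0) -> prime_ideal [set f | ray a f = 0].
Proof.
move=> [j aj]; split; first split=> /=.
- by rewrite inE /= rmorph0.
- by rewrite notin_setE /= rmorph1 => /eqP; rewrite oner_eq0.
- move=> h f g; rewrite !inE /= => f0 g0.
  by rewrite rmorphD rmorphM /= f0 g0 mulr0 addr0.
- move=> f g; rewrite !inE /= rmorphM /= => /eqP; rewrite mulf_eq0.
  by case/orP=> /eqP e; apply/orP; [left|right]; rewrite inE.
Qed.

(** Substituting (a i / a j) X_j for each X_i factors through [ray a], hence kills f; and f minus
    its substitution is a combination of the linear equations of the point. *)
Lemma ray_root_expansion a (j : 'I_3) f : a j != 0 -> ray a f = 0 ->
  exists q, f = \sum_i q i * ('X_i - (a i / a j)%:MP * 'X_j).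
Proof.
move=> aj af0; have [q qE] := sub_mmap_divides (fun i => (a i / a j)%:MP * 'X_j) f.
exists q; rewrite -qE -[LHS]subr0; congr (_ - _).
transitivity ((map_poly (@mpolyC 3 K) (ray a f)).[(a j)^-1%:MP * 'X_j]).
  by rewrite af0 rmorph0 horner0.
symmetry; apply: (@mpoly_rmorph_ext _ _ _ (mmap (@mpolyC 3 K) _)
  (horner_eval _ \o map_poly (@mpolyC 3 K) \o ray a)) => [c|i] /=.
  by rewrite mmapC rayC map_polyC /= /horner_eval !hornerC.
rewrite mmap_X rayX [in RHS]rmorphM /= map_polyC /= map_polyX /horner_eval.
by rewrite hornerM hornerC hornerX mulrA -mpolyCM.
Qed.

(** The witness f avoids the point and carries each linear equation of the point into I. So (I : f)
    contains the prime by the expansion, and lies in it because I does and f does not. *)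
Lemma ray_ker_associated a (j : 'I_3) f : fermat_point a -> a j != 0 ->
  ray a f != 0 -> (forall i, I (f * ('X_i - (a i / a j)%:MP * 'X_j))) ->
  associated_primes I [set g | ray a g = 0].
Proof.
move=> a_pt aj af fI; split; first by apply: ray_ker_prime; exists j.
exists f; apply/seteqP; split=> g /=.
  move=> ag; have [q ->] := ray_root_expansion aj ag.
  rewrite mulr_suml; apply: ideal_gen_sum => i _.
  by rewrite -mulrA [_ * f]mulrC; apply: ideal_genMl; apply: fI.
move=> /(ray_fermat_ideal a_pt)/eqP; rewrite rmorphM /= mulf_eq0 (negPf af) orbF.
by move/eqP.
Qed.

End FermatPoints.

(** * Fermat points and associated primes *)

Section FermatPointsAssociated.
Variables (K : numFieldType) (n : nat).
Hypothesis n_gt0 : (0 < n)%N.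

Local Notation S := {mpoly K[3]}.
Local Notation I := (fermat_ideal K n).
Local Notation x := ('X_o0 : S).
Local Notation y := ('X_o1 : S).
Local Notation z := ('X_o2 : S).
Implicit Types (a : 'I_3 -> K) (f : S).

Let n_neq0 : (n == 0%N) = false. Proof. by case: n n_gt0. Qed.

Lemma monomX_neq0 (c : K) k : c != 0 -> (c%:P * 'X : {poly K}) ^+ k != 0.
Proof. by move=> c0; rewrite expf_neq0 // mulf_neq0 ?polyC_eq0 ?polyX_eq0. Qed.

(** At (1:0:0) the witness is vw: it does not vanish there, while yv and zw lie in I. The other two
    points are symmetric. *)
Lemma coordinate_point_associated a (j : 'I_3) : a j != 0 ->
  (forall i, i != j -> a i = 0) -> associated_primes I [set g | ray a g = 0].
Proof.
move=> aj a0; have [Ixu Iyv Izw] := fermat_ideal_gens K n.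
have a_pt : fermat_point n a by right; exists j.
have cancel (f : S) : I (f * ('X_j - (a j / a j)%:MP * 'X_j)).
  by rewrite divff // mpolyC1 mul1r subrr mulr0; apply: ideal_gen0.
have vanish (f : S) i : i != j -> I (f * 'X_i) -> I (f * ('X_i - (a i / a j)%:MP *
  'X_j)).
  by move=> ij; rewrite (a0 i ij) mul0r mpolyC0 mul0r subr0.
move: j aj a0 cancel vanish; apply: ord3P => aj a0 cancel vanish.
- apply: (@ray_ker_associated _ _ _ _ o0 ((z ^+ n - x ^+ n) * (x ^+ n - y ^+ n))) => //.
    rewrite rmorphM !rmorphB !rmorphXn /= !rayX (a0 o1) // (a0 o2) //.
    by rewrite !mul0r !expr0n n_neq0 subr0 sub0r mulf_neq0 ?oppr_eq0 ?monomX_neq0.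
  apply: ord3P => //; apply: vanish => //.
    by rewrite mulrC mulrA; apply: ideal_genMr.
  by rewrite -mulrA [_ * z]mulrC; apply: ideal_genMl.
- apply: (@ray_ker_associated _ _ _ _ o1 ((y ^+ n - z ^+ n) * (x ^+ n - y ^+ n))) => //.
    rewrite rmorphM !rmorphB !rmorphXn /= !rayX (a0 o0) // (a0 o2) //.
    by rewrite !mul0r !expr0n n_neq0 subr0 sub0r mulf_neq0 ?oppr_eq0 ?monomX_neq0.
  apply: ord3P => //; apply: vanish => //.
    by rewrite mulrC mulrA; apply: ideal_genMr.
  by rewrite -mulrA [_ * z]mulrC; apply: ideal_genMl.
- apply: (@ray_ker_associated _ _ _ _ o2 ((y ^+ n - z ^+ n) * (z ^+ n - x ^+ n))) => //.
    rewrite rmorphM !rmorphB !rmorphXn /= !rayX (a0 o0) // (a0 o1) //.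
    by rewrite !mul0r !expr0n n_neq0 subr0 sub0r mulf_neq0 ?oppr_eq0 ?monomX_neq0.
  apply: ord3P => //; apply: vanish => //.
    by rewrite mulrC mulrA; apply: ideal_genMr.
  by rewrite -mulrA [_ * y]mulrC; apply: ideal_genMl.
Qed.

Lemma general_point_associated a : (forall i, a i != 0) ->
  (forall i j, a i ^+ n = a j ^+ n) -> associated_primes I [set g | ray a g = 0].
Proof.
move=> a0 an; have [Ixu Iyv Izw] := fermat_ideal_gens K n.
have a_pt : fermat_point n a by left.
pose c i : S := (a i / a o0)%:MP * x.
have cn i : c i ^+ n = x ^+ n.
  rewrite exprMn -rmorphXn expr_div_n (an i o0) divff ?expf_neq0 //=.
  by rewrite mpolyC1 mul1r.
(* The cofactor of the equation X_i - c_i in X_i^n - x^n. On the ray it is n times a power of (a i)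
   X, nonzero in characteristic 0. With the factor xyz it turns each equation of the point into a
   multiple of a generator of I. *)
pose Q i : S := \sum_(k < n) 'X_i ^+ (n.-1 - k) * c i ^+ k.
have QE i : ('X_i - c i) * Q i = 'X_i ^+ n - x ^+ n by rewrite -subrXX cn.
have Q0 i : ray a (Q i) != 0.
  rewrite rmorph_sum /= (eq_bigr (fun=> ((a i)%:P * 'X) ^+ n.-1)) => [|k _].
    rewrite sumr_const card_ord -mulr_natl mulf_neq0 ?monomX_neq0 //.
    by rewrite -polyC_natr polyC_eq0 pnatr_eq0 n_neq0.
  rewrite rmorphM !rmorphXn rmorphM /= !rayX rayC mulrA -polyCM divfK //.
  by rewrite -exprD subnK // -ltnS prednK.
apply: (@ray_ker_associated _ _ _ _ o0 (x * y * z * Q o1 * Q o2)) => //.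
  by rewrite !rmorphM /= !rayX !mulf_neq0 // ?polyC_eq0 ?polyX_eq0.
apply: ord3P.
- by rewrite divff // mpolyC1 mul1r subrr mulr0; apply: ideal_gen0.
- have -> : x * y * z * Q o1 * Q o2 * (y - c o1) =
     - (x * y * Q o2) * (z * (x ^+ n - y ^+ n)).
    by rewrite -[x ^+ n - _]opprB -QE; ring.
  exact: ideal_genMl.
- have -> : x * y * z * Q o1 * Q o2 * (z - c o2) =
     (x * z * Q o1) * (y * (z ^+ n - x ^+ n)).
    by rewrite -QE; ring.
  exact: ideal_genMl.
Qed.

Lemma symbolic_power_vanishing m f :
  symbolic_power I m f -> vanishing_order_ge n m f.
Proof.
move=> /symbolic_powerP fI h h_arc; have [a [j a_pt h0]] := h_arc.
have [s as0 sf] : exists2 s, ~ [set g | ray a g = 0] s & ideal_pow I m (s * f).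
  apply: fI; case: a_pt => [[a0 an]|[i ai a0]].
    exact: general_point_associated a0 an.
  exact: coordinate_point_associated ai a0.
have := arc_eval_fermat_ideal_pow n_gt0 h_arc sf.
rewrite rmorphM mulrC; apply: order_ge_cancel.
by apply: arc_eval_coef0_neq0 h0 _; apply/eqP.
Qed.

End FermatPointsAssociated.

(** * Fat points at four general points of the plane *)

Lemma mmap3E (K : fieldType) (T : comNzRingType) (f : {rmorphism K -> T})
    (h : 'I_3 -> T) (p : {mpoly K[3]}) :
  mmap f h p = \sum_(m <- msupp p)
    f p@_m * (h o0 ^+ m o0 * h o1 ^+ m o1 * h o2 ^+ m o2).
Proof.
rewrite /mmap; apply: eq_bigr => m _; congr (_ * _).
rewrite /mmap1 !big_ord_recl big_ord0 mulr1 mulrA.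
by congr (h _ ^+ m _ * h _ ^+ m _ * h _ ^+ m _); apply: val_inj.
Qed.

Lemma order_ge_fermat_prod (S : idomainType) n (x y z : {poly S})
    ex ey ez eu ev ew i j k al be ga :
  order_ge ex x -> order_ge ey y -> order_ge ez z ->
  order_ge eu (y ^+ n - z ^+ n) -> order_ge ev (z ^+ n - x ^+ n) ->
  order_ge ew (x ^+ n - y ^+ n) ->
  order_ge (ex * i + ey * j + ez * k + eu * al + ev * be + ew * ga)
    (fermat_prod n x y z i j k al be ga).
Proof. by move=> *; do !apply: order_geM; apply: order_geX. Qed.

(* Bezout for a line through two points, of multiplicities m and a, in the
   coordinate whose n-th power is the coordinate of the line. *)
Lemma binary_form_eq0 (K : numFieldType) (n d m a : nat) (g : {poly K}) :
  (0 < n)%N -> (size g <= d.+1)%N -> (n * d < n * m + a)%N ->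
  order_ge m (g \Po (1 + 'X) ^+ n) -> order_ge a (g \Po 'X^n) -> g = 0.
Proof.
move=> n_gt0 gd dma gm ga; apply: contraTeq dma => g0; rewrite -leqNgt.
(* Write g = (X - 1)^l q with q(1) nonzero. As (1 + X)^n - 1 is X times a polynomial of value n at
   0, the first order gives m <= l. As X^n - 1 is nonzero at 0, the second order falls on q(X^n), so
   n deg q >= a. Adding degrees gives nd >= nm + a. *)
have [l [q +]] := multiplicity_XsubC g 1; rewrite g0 /= => q1 gE.
have q0 : q != 0 by apply: contraNneq g0 => q0; rewrite gE q0 mul0r.
pose r : {poly K} := \sum_(i < n) (1 + 'X) ^+ (n.-1 - i) * 1 ^+ i.
have rE : (1 + 'X) ^+ n - 1 = r * 'X.
  by rewrite -[X in _ - X](expr1n _ n) subrXX [1 + 'X]addrC addrK mulrC addrC.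
have r0 : r.[0] != 0.
  rewrite horner_sum (eq_bigr (fun=> 1)) => [|i _].
    by rewrite sumr_const card_ord pnatr_eq0 -lt0n.
  by rewrite hornerM !horner_exp hornerD hornerX !hornerC addr0 !expr1n mulr1.
have qr0 : ((q \Po (1 + 'X) ^+ n) * r ^+ l)`_0 != 0.
  rewrite -horner_coef0 hornerM horner_exp horner_comp !horner_exp.
  by rewrite hornerD hornerX hornerC addr0 expr1n mulf_neq0 // expf_neq0.
have le_ml : (m <= l)%N.
  rewrite -subn_eq0.
  have : order_ge (m - l) (1 : {poly K}).
    apply: (order_ge_cancelX qr0).
    rewrite mul1r -mulrA -exprMn -rE; move: gm; rewrite gE rmorphM rmorphXn /=.
    by rewrite rmorphB /= comp_polyX comp_polyC.
  by case: (m - l)%N => // k /order_ge_coef/(_ (ltn0Sn _))/eqP; rewrite coefC oner_eq0.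
have qa : order_ge a (q \Po 'X^n).
  apply: (@order_ge_cancel _ _ _ (('X^n - 1) ^+ l)).
    rewrite -horner_coef0 horner_exp hornerD hornerN hornerXn hornerC expr0n.
    by rewrite -[n == _]negbK -lt0n n_gt0 sub0r expf_neq0 // oppr_eq0 oner_eq0.
  move: ga; rewrite gE rmorphM rmorphXn /=.
  by rewrite rmorphB /= comp_polyX comp_polyC.
have qn0 : q \Po 'X^n != 0.
  by rewrite comp_poly_eq0 // size_polyXn ltnS.
have := order_ge_size qa qn0; rewrite -[size _]prednK ?size_poly_gt0 // ltnS.
rewrite size_comp_poly size_polyXn /= => le_a.
move: gd; rewrite gE size_mul ?expf_neq0 ?polyXsubC_eq0 // size_exp_XsubC.
rewrite addnS /= -ltnS -(@prednK (size q)) ?size_poly_gt0 // addSn !ltnS => le_d.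
rewrite (leq_trans _ (leq_mul (leqnn n) le_d)) // mulnDr addnC leq_add //.
  by rewrite mulnC.
by rewrite leq_mul2l le_ml orbT.
Qed.

Section FourPoints.
Variables (K : numFieldType) (n : nat).
Hypothesis n_gt0 : (0 < n)%N.

Local Notation S := {mpoly K[3]}.
Local Notation x := ('X_o0 : S).
Local Notation y := ('X_o1 : S).
Local Notation z := ('X_o2 : S).
Implicit Types (F : S) (w : 'I_3 -> nat).

Lemma mpolyX_neq0 (i : 'I_3) : ('X_i : S) != 0.
Proof. by rewrite -msize_poly_eq0 msizeX. Qed.

Definition power_subst : {rmorphism S -> S} :=
  locked (mmap (@mpolyC 3 K) (fun i => 'X_i ^+ n) : {rmorphism S -> S}).

Lemma power_substX i : power_subst 'X_i = 'X_i ^+ n.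
Proof. by rewrite /power_subst -lock; apply: mmap_X. Qed.

Lemma power_substC c : power_subst c%:MP = c%:MP.
Proof. by rewrite /power_subst -lock; apply: mmapC. Qed.

(* Arcs through the point (1:1:1), resp. through a coordinate point, for w the
   indicator function of the two vanishing coordinates. *)
Definition unit_arc : 'I_3 -> {poly S} :=
  locked (fun i => if i == o0 then x%:P else x%:P + ('X_i)%:P * 'X).

Lemma unit_arcE i :
  unit_arc i = if i == o0 then x%:P else x%:P + ('X_i)%:P * 'X.
Proof. by rewrite /unit_arc -lock. Qed.

Definition weight_arc w : 'I_3 -> {poly S} :=
  locked (fun i => ('X_i)%:P * 'X^(w i)).

Lemma weight_arcE w i : weight_arc w i = ('X_i)%:P * 'X^(w i).
Proof. by rewrite /weight_arc -lock. Qed.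

Lemma weight_arc_exp w i : weight_arc w i ^+ n = ('X_i ^+ n)%:P * 'X^(n * w i).
Proof. by rewrite weight_arcE exprMn -exprM polyC_exp mulnC. Qed.

(** The coefficients of the arc are independent indeterminates, so distinct monomials of F cannot
    cancel and each meets the order bound by itself. *)
Lemma order_ge_weight_arc w b F m : order_ge b (arc_eval (weight_arc w) (power_subst
  F)) ->
  m \in msupp F -> (b <= n * \sum_i w i * m i)%N.
Proof.
move=> Fb Fm; rewrite leqNgt; apply/negP => lt_b.
have := order_ge_coef Fb lt_b; rewrite {1}[F]mpolyE !rmorph_sum /= coef_sum.
move/(congr1 (mcoeff (m *+ n)));
  rewrite mcoeff0 raddf_sum /= (bigD1_seq m Fm (msupp_uniq _)) /=.
have term m' : arc_eval (weight_arc w) (power_subst (F@_m' *: 'X_[m'])) =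
    (F@_m' *: 'X_[m' *+ n])%:P * 'X^(n * \sum_i w i * m' i).
  rewrite -!mul_mpolyC !rmorphM /= power_substC arc_evalC -mulrA; congr (_ * _).
  rewrite mpolyXE_id rmorph_prod rmorph_prod /= -mpolyXn mpolyXE_id -prodrXl.
  rewrite rmorph_prod /= big_distrr /= expr_sum -big_split /=.
  apply: eq_bigr => i _; rewrite !rmorphXn /= power_substX rmorphXn /= arc_evalX.
  rewrite weight_arcE !exprMn -!exprM; congr (_ * _); congr (_ ^+ _);
    first by rewrite mulnC.
  exact: mulnCA.
rewrite term coefMXn ltnn subnn coefC /= mcoeffZ mcoeffX eqxx mulr1.
rewrite big1_seq ?addr0 => [/eqP|m' /andP[m'm _]].
  by rewrite mcoeff_eq0 Fm.
rewrite term coefMXn; case: ifP => _; first by rewrite mcoeff0.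
rewrite coefC; case: ifP => _; last by rewrite mcoeff0.
rewrite mcoeffZ mcoeffX (_ : _ == _ = false) ?mulr0 //.
apply: contraNF m'm => /eqP/mnmP e; apply/eqP/mnmP => i.
by move: (e i); rewrite !mulmnE => /eqP; rewrite eqn_pmul2r // => /eqP.
Qed.

Local Notation w1 := (fun i : 'I_3 => (i != o0) : nat).
Local Notation w2 := (fun i : 'I_3 => (i != o1) : nat).
Local Notation w3 := (fun i : 'I_3 => (i != o2) : nat).

Definition fat_form (d m a b c : nat) F : Prop :=
  [/\ F \is d.-homog, order_ge m (arc_eval unit_arc (power_subst F)),
      order_ge a (arc_eval (weight_arc w1) (power_subst F)),
      order_ge b (arc_eval (weight_arc w2) (power_subst F))
    & order_ge c (arc_eval (weight_arc w3) (power_subst F))].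

Section Closure.
Variables d m a b c : nat.

Lemma fat_form0 : fat_form d m a b c 0.
Proof. by split; rewrite ?rmorph0; [exact: dhomog0|..]; apply: order_ge_zero. Qed.

Lemma fat_formD F G : fat_form d m a b c F -> fat_form d m a b c G ->
  fat_form d m a b c (F + G).
Proof.
move=> [F1 F2 F3 F4 F5] [G1 G2 G3 G4 G5].
split; rewrite ?rmorphD; [exact: dhomogD|exact: order_geD F2 G2
  |exact: order_geD F3 G3|exact: order_geD F4 G4|exact: order_geD F5 G5].
Qed.

Lemma fat_formZ k F : fat_form d m a b c F -> fat_form d m a b c (k *: F).
Proof.
move=> [F1 F2 F3 F4 F5]; split; rewrite -?mul_mpolyC ?rmorphM;
  [by rewrite mul_mpolyC; apply: dhomogZ|exact: order_geMl F2
  |exact: order_geMl F3|exact: order_geMl F4|exact: order_geMl F5].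
Qed.

Lemma fat_formB F G : fat_form d m a b c F -> fat_form d m a b c G ->
  fat_form d m a b c (F - G).
Proof. by rewrite -scaleN1r => hF hG; apply: fat_formD => //; apply: fat_formZ. Qed.

End Closure.

Let n_neq0 : (n == 0%N) = false. Proof. by case: n n_gt0. Qed.

Lemma unit_arc_coef0 i : (unit_arc i)`_0 = x.
Proof.
rewrite unit_arcE; case: eqP => _; rewrite -horner_coef0.
  by rewrite hornerC.
by rewrite hornerD hornerM !hornerC hornerX mulr0 addr0.
Qed.

Lemma order_ge1_subX (p q : {poly S}) k l : p`_0 = q`_0 ->
  order_ge 1 ((p ^+ k) ^+ l - (q ^+ k) ^+ l).
Proof.
move=> pq; apply: order_ge1.
by rewrite -horner_coef0 hornerD hornerN !horner_exp !horner_coef0 pq subrr.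
Qed.

Lemma fat_form_prod m a b c i j k al be ga :
  fat_exponents n m a b c (n * i) (n * j) (n * k) al be ga ->
  fat_form (i + j + k + al + be + ga) m a b c (fermat_prod 1 x y z i j k al be ga).
Proof.
case/and4P=> hm ha hb hc.
have homX k' (p : S) : p \is 1.-homog -> p ^+ k' \is k'.-homog.
  by move=> p1; have := dhomogMn k' p1; rewrite mul1n.
have XE h i' : arc_eval h (power_subst 'X_i') = h i' ^+ n.
  by rewrite power_substX rmorphXn /= arc_evalX.
have unitB i' j' : order_ge 1 ((unit_arc i' ^+ n) ^+ 1 - (unit_arc j' ^+ n) ^+ 1).
  by apply: order_ge1_subX; rewrite (unit_arc_coef0 i') (unit_arc_coef0 j').
have ordX w i' : w i' = 1%N -> order_ge n (weight_arc w i' ^+ n).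
  by rewrite weight_arc_exp => ->; rewrite muln1; exists ('X_i' ^+ n)%:P.
have ordB w i' j' : w i' = 1%N -> w j' = 1%N ->
  order_ge n ((weight_arc w i' ^+ n) ^+ 1 - (weight_arc w j' ^+ n) ^+ 1).
  by move=> wi wj; exact: order_geD (ordX _ _ wi) (order_geN (ordX _ _ wj)).
split.
- have X1 i' : 'X_i' \is [in K[3], 1.-homog] by rewrite dhomogX /= mdeg1.
  have B1 i' j' : 'X_i' - 'X_j' \is [in K[3], 1.-homog] by apply: rpredB.
  by rewrite /fermat_prod !expr1; do 5!(apply: dhomogM; last exact: homX); apply: homX.
- rewrite !rmorph_fermat_prod !XE.
  have := order_ge_fermat_prod i j k al be ga (order_ge0 (unit_arc o0 ^+ n))
    (order_ge0 (unit_arc o1 ^+ n)) (order_ge0 (unit_arc o2 ^+ n))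
    (unitB o1 o2) (unitB o2 o0) (unitB o0 o1).
  by apply: order_ge_leq; rewrite !mul0n !mul1n.
- rewrite !rmorph_fermat_prod !XE.
  have := order_ge_fermat_prod i j k al be ga (order_ge0 (weight_arc w1 o0 ^+ n))
    (ordX w1 o1 erefl)
    (ordX w1 o2 erefl) (ordB w1 o1 o2 erefl erefl) (order_ge0 _) (order_ge0 _).
  by apply: order_ge_leq; apply: leq_trans ha _; lia.
- rewrite !rmorph_fermat_prod !XE.
  have := order_ge_fermat_prod i j k al be ga (ordX w2 o0 erefl)
    (order_ge0 (weight_arc w2 o1 ^+ n))    (ordX w2 o2 erefl) (order_ge0 _) (ordB w2
      o2 o0 erefl erefl) (order_ge0 _).
  by apply: order_ge_leq; apply: leq_trans hb _; lia.
- rewrite !rmorph_fermat_prod !XE.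
  have := order_ge_fermat_prod i j k al be ga (ordX w3 o0 erefl) (ordX w3 o1 erefl)
    (order_ge0 (weight_arc w3 o2 ^+ n)) (order_ge0 _) (order_ge0 _) (ordB w3 o0 o1
      erefl erefl).
  by apply: order_ge_leq; apply: leq_trans hc _; lia.
Qed.

Lemma order_ge_weight_cancel w i e (A : {poly S}) :
  order_ge e (A * weight_arc w i ^+ n) -> order_ge (e - n * w i) A.
Proof.
rewrite weight_arc_exp => h; apply: order_ge_cancelX h; rewrite coefC /=.
by rewrite expf_neq0 // mpolyX_neq0.
Qed.

Lemma sub_powers_neq0 (i j : 'I_3) : i != j -> ('X_i ^+ n - 'X_j ^+ n : S) != 0.
Proof.
move=> ij; apply/eqP => /(congr1 (mmap (idfun : {rmorphism K -> K}) (fun k => (k ==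
  i)%:R))).
rewrite rmorphB !rmorphXn /= !mmap_X eqxx eq_sym (negPf ij) expr1n expr0n n_neq0.
by rewrite subr0 rmorph0 => /eqP; rewrite oner_eq0.
Qed.

(** After substitution x becomes x^n, of order n at (0:1:0) and (0:0:1) and order 0 at the other two
    points. Truncated subtraction means that no condition remains once an order is used up. *)
Lemma fat_form_divX d m a b c F : F != 0 -> fat_form d m a b c (F * x) ->
  (0 < d)%N /\ fat_form d.-1 m a (b - n) (c - n) F.
Proof.
move=> F0 [Fd F1 F2 F3 F4].
have x1 : x \is [in K[3], 1.-homog] by rewrite dhomogX /= mdeg1.
have [d0 Fd'] := dhomog_mul_cancel (mpolyX_neq0 _) F0 x1 Fd.
move: F1 F2 F3 F4; rewrite !rmorphM !power_substX !rmorphXn /= !arc_evalX.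
move=> F1 /order_ge_weight_cancel F2 /order_ge_weight_cancel F3
  /order_ge_weight_cancel F4.
split=> //; split; first by rewrite -subn1.
- apply: order_ge_cancel F1; rewrite -horner_coef0 horner_exp horner_coef0.
  by rewrite unit_arc_coef0 expf_neq0 // mpolyX_neq0.
- by move: F2; rewrite muln0 subn0.
- by move: F3; rewrite muln1.
- by move: F4; rewrite muln1.
Qed.

Lemma fat_form_divU d m a b c F : F != 0 -> fat_form d m a b c (F * (y - z)) ->
  (0 < d)%N /\ fat_form d.-1 (m - 1) (a - n) b c F.
Proof.
move=> F0 [Fd F1 F2 F3 F4].
have X1 i' : 'X_i' \is [in K[3], 1.-homog] by rewrite dhomogX /= mdeg1.
have U1 : y - z \is [in K[3], 1.-homog] by apply: rpredB.
have U0 : y - z != 0.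
  apply/eqP => /eqP; rewrite subr_eq0 => /eqP yz.
  by have := @sub_powers_neq0 o1 o2 isT; rewrite yz subrr eqxx.
have [d0 Fd'] := dhomog_mul_cancel U0 F0 U1 Fd.
move: F1 F2 F3 F4; rewrite !rmorphM !rmorphB !power_substX !rmorphXn /= !arc_evalX.
move=> F1 F2 F3 F4; split=> //; split; first by rewrite -subn1.
(* Along the unit arc y^n - z^n becomes (y - z) X r, and r has constant coefficient n x^(n-1), so
   exactly one order is lost. *)
- pose r : {poly S} := \sum_(i < n) unit_arc o1 ^+ (n.-1 - i) * unit_arc o2 ^+ i.
  apply: (@order_ge_cancelX _ _ 1 _ ((y - z)%:P * r)).
    rewrite -horner_coef0 hornerM hornerC mulf_neq0 // horner_sum.
    rewrite (eq_bigr (fun=> x ^+ n.-1)) => [|i _].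
      rewrite sumr_const card_ord -mulr_natl mulf_neq0 ?expf_neq0 ?mpolyX_neq0 //.
      by rewrite -mpolyC_nat mpolyC_eq0 pnatr_eq0 n_neq0.
    rewrite hornerM !horner_exp !horner_coef0 !unit_arc_coef0 -exprD subnK //.
    by rewrite -ltnS prednK.
  congr (order_ge m (_ * _)): F1; rewrite subrXX -/r !unit_arcE /= opprD addrACA.
  by rewrite subrr add0r -mulrBl -polyCB mulrAC.
- move: F2; rewrite !weight_arc_exp /= muln1 -mulrBl -polyCB.
  by apply: order_ge_cancelX; rewrite coefC /=; apply: sub_powers_neq0.
- apply: order_ge_cancel F3; rewrite !weight_arc_exp /= muln0 muln1 mulr1.
  by rewrite coefB coefMXn n_gt0 subr0 coefC /= expf_neq0 // mpolyX_neq0.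
- apply: order_ge_cancel F4; rewrite !weight_arc_exp /= muln0 muln1 mulr1.
  by rewrite coefB coefMXn n_gt0 sub0r coefC /= oppr_eq0 expf_neq0 // mpolyX_neq0.
Qed.

End FourPoints.

(** * Generation by products: the line y = z and reduction modulo x *)

Section FourPointsGeneration.
Variables (K : numFieldType) (n : nat).
Hypothesis n_gt0 : (0 < n)%N.

Local Notation S := {mpoly K[3]}.
Local Notation x := ('X_o0 : S).
Local Notation y := ('X_o1 : S).
Local Notation z := ('X_o2 : S).
Implicit Types (F : S) (w : 'I_3 -> nat).
Local Notation w1 := (fun i : 'I_3 => (i != o0) : nat).
Local Notation w2 := (fun i : 'I_3 => (i != o1) : nat).
Local Notation w3 := (fun i : 'I_3 => (i != o2) : nat).
Local Notation fat_form := (@fat_form K n).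
Local Notation power_subst := (@power_subst K n).
Local Notation unit_arc := (@unit_arc K).
Local Notation weight_arc := (@weight_arc K).
Lemma fermat_prod_exp (T : comNzRingType) (u v w : T) i j k al be ga :
  fermat_prod 1 (u ^+ n) (v ^+ n) (w ^+ n) i j k al be ga =
  fermat_prod n u v w (n * i) (n * j) (n * k) al be ga.
Proof. by rewrite /fermat_prod !expr1 !exprM. Qed.

Lemma sum3 (f : 'I_3 -> nat) : (\sum_i f i = f o0 + f o1 + f o2)%N.
Proof.
rewrite !big_ord_recl big_ord0 addn0 addnA.
by congr (f _ + f _ + f _)%N; apply: val_inj.
Qed.

Lemma mdeg3 (m : 'X_{1..3}) : mdeg m = (m o0 + m o1 + m o2)%N.
Proof. by rewrite mdegE sum3. Qed.

Lemma sub_subst1_divides (i : 'I_3) (p : S) F :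
  mmap (@mpolyC 3 K) (fun j => if j == i then p else 'X_j) F = 0 ->
  exists q, F = q * ('X_i - p).
Proof.
move=> F0; have [q] := sub_mmap_divides (fun j => if j == i then p else 'X_j) F.
rewrite F0 subr0 (bigD1 i) //= eqxx big1 => [|j /negPf->]; last first.
  by rewrite subrr mulr0.
by rewrite addr0 => ->; exists (q i).
Qed.

(* The line y = z passes through (1:1:1) and (1:0:0). *)
Lemma fat_form_line d m a b c F : fat_form d m a b c F -> (n * d < n * m + a)%N ->
  exists G, F = G * (y - z).
Proof.
move=> [Fd F1 F2 _ _] lt_d.
pose g := mmap (@polyC K) (fun i : 'I_3 => if i == o0 then 1 else 'X) F.
have gE : g = \sum_(m <- msupp F) F@_m *: 'X^(m o1 + m o2).
  rewrite /g mmap3E; apply: eq_bigr => k _ /=.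
  by rewrite expr1n mul1r -exprD mul_polyC.
have degF k : k \in msupp F -> (k o0 + k o1 + k o2)%N = d.
  by move=> /(dhomog_mf Fd) <-; rewrite /= mdeg3.
(* Setting the indeterminate coefficients to 1 specializes the two arcs to (1, 1 + X, 1 + X) and (1,
   X, X), both inside the line y = z. *)
pose ev := mmap (idfun : {rmorphism K -> K}) (fun _ : 'I_3 => 1).
have evg h (v : {poly K}) : map_poly ev (h o0) ^+ n = 1 ->
    map_poly ev (h o1) ^+ n = v -> map_poly ev (h o2) ^+ n = v ->
    map_poly ev (arc_eval h (power_subst F)) = g \Po v.
  move=> h0 h1 h2.
  apply: (@mpoly_rmorph_ext _ _ _ (map_poly ev \o arc_eval h \o power_subst)
     (comp_poly v \o mmap (@polyC K) (fun i : 'I_3 => if i == o0 then 1 else 'X))) =>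
       [k|].
    by rewrite /= power_substC arc_evalC map_polyC /= !mmapC comp_polyC.
  by apply: ord3P => /=;
    rewrite power_substX rmorphXn /= arc_evalX rmorphXn /= mmap_X /=
    ?comp_polyX ?rmorph1.
have g0 : g = 0.
  apply: (@binary_form_eq0 _ n d m a) => //.
  - rewrite gE; apply: (leq_trans (size_sum _ _ _)); apply/bigmax_leqP_seq => k kF _.
    apply: (leq_trans (size_scale_leq _ _)); rewrite size_polyXn ltnS -(degF k kF).
    by rewrite -addnA leq_addl.
  - rewrite -(evg unit_arc) //; first exact: order_ge_map.
    + by rewrite unit_arcE /= map_polyC /= mmap_X expr1n.
    + by rewrite unit_arcE /= rmorphD rmorphM /= !map_polyC /= !mmap_X map_polyX mul1r.
    + by rewrite unit_arcE /= rmorphD rmorphM /= !map_polyC /= !mmap_X map_polyX mul1r.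
  - rewrite -(evg (weight_arc w1)) //; first exact: order_ge_map.
    + by rewrite weight_arcE /= rmorphM /= map_polyC /= mmap_X mul1r rmorph1 expr1n.
    + by rewrite weight_arcE /= rmorphM /= map_polyC /= mmap_X mul1r map_polyX.
    + by rewrite weight_arcE /= rmorphM /= map_polyC /= mmap_X mul1r map_polyX.
apply: sub_subst1_divides; rewrite mmap3E /=.
(* F(x, z, z) is the homogenization of g in degree d, so it vanishes with g. *)
transitivity (\sum_(k < d.+1) g`_k *: (x ^+ (d - k) * z ^+ k)).
  rewrite gE; under [RHS]eq_bigr do rewrite coef_sum scaler_suml.
  rewrite exchange_big /= big_seq [RHS]big_seq; apply: eq_bigr => k kF.
  have lt_k : (k o1 + k o2 < d.+1)%N by rewrite ltnS -(degF k kF) -addnA leq_addl.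
  rewrite (bigD1 (Ordinal lt_k)) //= big1 ?addr0 => [|l ne_l].
    rewrite coefZ coefXn eqxx mulr1 -mul_mpolyC -mulrA -exprD.
    by rewrite -(degF k kF) -addnA addnK.
  rewrite coefZ coefXn (_ : _ == _ = false) ?mulr0 ?scale0r //.
  by apply: contraNF ne_l => /eqP e; apply/eqP/val_inj.
by rewrite g0 big1 // => k _; rewrite coef0 scale0r.
Qed.

(* Modulo x the forms v and w become z^n and -y^n, so that every monomial of degree d
   in y and z lifts to a product with enough factors v, w. *)
Lemma fat_form_lift_mod_x d m a b c F : fat_form d m a b c F -> (n * m + a <= n * d)%N
  ->
  exists G, [/\ fat_form d m a b c G,
    ideal_gen (fat_products n x y z m a b c) (power_subst G)
    & exists q, F - G = q * x].
Proof.
move=> FF le_d; have [Fd _ _ F3 F4] := FF.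
(* The order m at (1:1:1) is met by m factors, as many of them v as z^r allows and the rest w; m <=
   d = q + r makes the exponents honest. The sign undoes w = -y^n modulo x. The orders at the
   coordinate points become n(d - m), nr and nq: the first is at least a by hypothesis, the others
   are bounded through the monomials of F. *)
pose be r := minn m r; pose gen q r := (-1) ^+ (m - be r) *:
  fermat_prod 1 x y z 0 (q - (m - be r)) (r - be r) 0 (be r) (m - be r).
pose G := \sum_(k <- msupp F | k o0 == 0%N) F@_k *: gen (k o1) (k o2).
have le_md : (m <= d)%N by rewrite -(leq_pmul2l n_gt0) (leq_trans _ le_d) ?leq_addr.
have kP k : k \in msupp F -> k o0 == 0%N ->
    [/\ (k o1 + k o2)%N = d, (b <= n * k o2)%N & (c <= n * k o1)%N].
  move=> kF /eqP k0; split.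
  - by rewrite -(dhomog_mf Fd kF) /= mdeg3 k0.
  - by have := order_ge_weight_arc n_gt0 F3 kF; rewrite sum3 /= k0 muln0 mul0n mul1n.
  - by have := order_ge_weight_arc n_gt0 F4 kF;
    rewrite sum3 /= k0 muln0 mul0n mul1n addn0.
have vld k : k \in msupp F -> k o0 == 0%N -> fat_exponents n m a b c (n * 0)
    (n * (k o1 - (m - be (k o2)))) (n * (k o2 - be (k o2))) 0 (be (k o2)) (m - be (k
      o2)).
  move=> kF k0; have [kd kb kc] := kP k kF k0.
  have bm : (be (k o2) <= m)%N by rewrite geq_minl.
  have bk : (be (k o2) <= k o2)%N by rewrite geq_minr.
  have kbm : (m - be (k o2) <= k o1)%N.
    by rewrite /be; case: (leqP m (k o2)) => ?; lia.
  apply/and4P; split; rewrite ?muln0 ?add0n ?addn0.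
  - by rewrite subnKC.
  - rewrite -mulnDr -(leq_add2l (n * m)) (leq_trans le_d) // -mulnDr leq_mul2l.
    by apply/orP; right; lia.
  - by rewrite -mulnDr subnKC.
  - by rewrite -mulnDr subnKC.
have genE k : k \in msupp F -> k o0 == 0%N ->
    ((k o1 - (m - be (k o2))) + (m - be (k o2)) = k o1)%N /\
    ((k o2 - be (k o2)) + be (k o2) = k o2)%N.
  move=> kF k0; have [kd _ _] := kP k kF k0; rewrite /be.
  by case: (leqP m (k o2)) => ?; split; lia.
exists G; split.
- rewrite /G big_seq_cond; elim/big_ind: _ => [|p q|k /andP[kF k0]].
  + exact: fat_form0.
  + exact: fat_formD.
  + do 2!apply: fat_formZ; have := fat_form_prod K n_gt0 (vld k kF k0).
    have [e1 e2] := genE k kF k0; have [kd _ _] := kP k kF k0.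
    by congr (fat_form _ _ _ _ _ _); lia.
- rewrite /G big_seq_cond rmorph_sum; apply: ideal_gen_sum => k /andP[kF k0] /=.
  rewrite /gen -!mul_mpolyC; do 2!(rewrite rmorphM; apply: ideal_genMl).
  apply: mem_ideal_gen; do 6!eexists; split; first exact: vld k kF k0.
  by rewrite rmorph_fermat_prod !power_substX fermat_prod_exp.
- suff [q ->] : exists q, F - G = q * (x - 0) by exists q; rewrite subr0.
  pose rho : {rmorphism S -> S} :=
    mmap (@mpolyC 3 K) (fun j : 'I_3 => if j == o0 then 0 else 'X_j).
  apply: sub_subst1_divides; rewrite -/(rho (F - G)) rmorphB.
  have rhoC e : rho e%:MP = e%:MP by exact: mmapC.
  have rhoX l : rho 'X_l = if l == o0 then 0 else 'X_l by exact: mmap_X.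
  have rhoF : rho F = \sum_(k <- msupp F) (F@_k)%:MP * (0 ^+ k o0 * y ^+ k o1 * z ^+ k
    o2).
    by exact: mmap3E.
  rewrite rhoF /G rmorph_sum [X in _ - X]big_mkcond -sumrB big_seq big1 // => k kF.
  have [k0|k0] := eqVneq (k o0) 0%N;
    last by rewrite expr0n (negPf k0) !mul0r mulr0 subr0.
  have [e1 e2] := genE k kF (introT eqP k0).
  apply/eqP; rewrite subr_eq0 k0 expr0 mul1r /gen -!mul_mpolyC; apply/eqP.
  rewrite [RHS]rmorphM rhoC; congr (_ * _).
  rewrite [RHS]rmorphM rhoC rmorph_fermat_prod !rhoX.
  rewrite /fermat_prod !expr0 !expr1 mul1r mulr1 subr0 sub0r rmorphXn rmorphN1.
  have -> : y ^+ k o1 = y ^+ (k o1 - (m - be (k o2))) * y ^+ (m - be (k o2)).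
    by rewrite -exprD e1.
  have -> : z ^+ k o2 = z ^+ (k o2 - be (k o2)) * z ^+ be (k o2) by rewrite -exprD e2.
  rewrite /= (exprNn y); have := sqrr_sign S (m - be (k o2)); rewrite expr2.
  move: ((-1) ^+ _ : S) => s s2; rewrite -[LHS]mul1r -s2; ring.
Qed.

Lemma fat_form_generated d m a b c F : fat_form d m a b c F ->
  ideal_gen (fat_products n x y z m a b c) (power_subst F).
Proof.
(* All orders vary in the induction: dividing by y - z lowers m and a, dividing by x lowers b and
   c. *)
have [D] := ubnP d; elim: D d m a b c F => // D IH d m a b c F; rewrite ltnS => dD FF.
have [->|F0] := eqVneq F 0; first by rewrite rmorph0; apply: ideal_gen0.
have [le|lt] := leqP (n * m + a) (n * d); last first.
  have [G GE] := fat_form_line FF lt; move: F0 FF; rewrite GE => F0 FF.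
  have G0 : G != 0 by apply: contraNneq F0 => ->; rewrite mul0r.
  have [d0 GG] := fat_form_divU n_gt0 G0 FF.
  have {IH} := IH _ _ _ _ _ _ _ GG; rewrite prednK // => /(_ dD).
  rewrite mulrC rmorphM rmorphB !power_substX;
    apply: ideal_gen_mul => _ [i [j [k [al [be [ga [vld ->]]]]]]].
  apply: mem_ideal_gen; exists i, j, k, al.+1, be, ga; split;
    last by rewrite fermat_produ.
  case/and4P: vld => h1 h2 h3 h4; apply/and4P; split=> //; first lia.
  by rewrite mulnS; lia.
have [G [GG Ggen [q FGq]]] := fat_form_lift_mod_x FF le.
have -> : F = q * x + G by rewrite -FGq subrK.
rewrite rmorphD; apply: ideal_genD => //.
have [->|q0] := eqVneq q 0; first by rewrite mul0r rmorph0; apply: ideal_gen0.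
have [d0 qq] : (0 < d)%N /\ fat_form d.-1 m a (b - n) (c - n) q.
  by apply: fat_form_divX => //; rewrite -FGq; apply: fat_formB.
have {IH} := IH _ _ _ _ _ _ _ qq; rewrite prednK // => /(_ dD).
rewrite mulrC rmorphM power_substX;
  apply: ideal_gen_mul => _ [i [j [k [al [be [ga [vld ->]]]]]]].
apply: mem_ideal_gen; exists (n + i)%N, j, k, al, be, ga; split.
  by case/and4P: vld => h1 h2 h3 h4; apply/and4P; split=> //; lia.
by rewrite -[j]add0n -[k]add0n fermat_prodXn !expr0 !mulr1 !add0n.
Qed.

End FourPointsGeneration.

(** * Isotypic decomposition *)

Section Isotypic.
Variables (K : numFieldType) (n : nat) (zeta : K).
Hypotheses (n_gt0 : (0 < n)%N) (prim_zeta : n.-primitive_root zeta).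

Local Notation S := {mpoly K[3]}.
Local Notation x := ('X_o0 : S).
Local Notation y := ('X_o1 : S).
Local Notation z := ('X_o2 : S).
Implicit Types (f : S) (lam : 'I_3 -> K) (u v : 'X_{1..3}).

Definition scale_vars lam : {rmorphism S -> S} :=
  locked (mmap (@mpolyC 3 K) (fun i => (lam i)%:MP * 'X_i) : {rmorphism S -> S}).

Definition weight lam u : K := \prod_i lam i ^+ u i.

Lemma scale_varsX lam i : scale_vars lam 'X_i = (lam i)%:MP * 'X_i.
Proof. by rewrite /scale_vars -lock; apply: mmap_X. Qed.

Lemma scale_varsC lam c : scale_vars lam c%:MP = c%:MP.
Proof. by rewrite /scale_vars -lock; apply: mmapC. Qed.

Lemma mcoeff_scale_vars lam f u : (scale_vars lam f)@_u = weight lam u * f@_u.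
Proof.
have scaleX v : scale_vars lam 'X_[v] = weight lam v *: 'X_[v].
  rewrite mpolyXE_id rmorph_prod -mul_mpolyC /weight rmorph_prod -big_split /=.
  by apply: eq_bigr => i _; rewrite !rmorphXn /= scale_varsX exprMn.
rewrite {1}[f]mpolyE rmorph_sum raddf_sum /=.
have [uf|uf] := boolP (u \in msupp f).
  rewrite (bigD1_seq u uf (msupp_uniq _)) /= big1 ?addr0 => [|v vu].
    rewrite -mul_mpolyC rmorphM scale_varsC scaleX -scalerAr mul_mpolyC !mcoeffZ.
    by rewrite mcoeffX eqxx mulr1.
  rewrite -mul_mpolyC rmorphM scale_varsC scaleX -scalerAr mul_mpolyC !mcoeffZ.
  by rewrite mcoeffX (negPf vu) !mulr0.
rewrite (memN_msupp_eq0 uf) mulr0 big_seq big1 // => v vf.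
rewrite -mul_mpolyC rmorphM scale_varsC scaleX -scalerAr mul_mpolyC !mcoeffZ.
rewrite mcoeffX (_ : v == u = false) ?mulr0 //.
by apply: contraNF uf => /eqP <-.
Qed.

(** Equal n-th powers, not necessarily 1: this includes the scalar matrices, which separate
    monomials of different degrees. *)
Definition torsion_scaling lam : Prop :=
  (forall i, lam i != 0) /\ (forall i j, lam i ^+ n = lam j ^+ n).

Lemma vanishing_order_ge_scale m lam f : torsion_scaling lam ->
  vanishing_order_ge n m f -> vanishing_order_ge n m (scale_vars lam f).
Proof.
move=> [lam0 lamn] fm h [a [j a_pt h0]].
pose h' i : {poly S} := (lam i)%:MP%:P * h i.
have -> : arc_eval h (scale_vars lam f) = arc_eval h' f.
  apply: (@mpoly_rmorph_ext _ _ _ (arc_eval h \o scale_vars lam) (arc_eval h')) =>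
    [c|i] /=.
    by rewrite scale_varsC !arc_evalC.
  by rewrite scale_varsX rmorphM arc_evalC !arc_evalX.
apply: fm; exists (fun i => lam i * a i), j => [|i]; last first.
  by rewrite coefCM h0 mulrA mpolyCM.
case: a_pt => [[a0 an]|[i ai a0]]; [left|right].
  split=> [i|i k]; first by rewrite mulf_neq0.
  by rewrite !exprMn (lamn i k) (an i k).
exists i; first by rewrite mulf_neq0.
by move=> k ki; rewrite a0 ?mulr0.
Qed.

Definition mnm_class u := (mdeg u, (u o0 %% n, u o1 %% n, u o2 %% n))%N.

Lemma weight_class lam u v : torsion_scaling lam -> mnm_class u = mnm_class v ->
  weight lam u = weight lam v.
Proof.
move=> [lam0 lamn] [duv uv0 uv1 uv2].
pose mu i := lam i / lam o0.
have mun i : mu i ^+ n = 1 by rewrite expr_div_n (lamn i o0) divff ?expf_neq0.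
have wE u' : weight lam u' = lam o0 ^+ mdeg u' * \prod_i mu i ^+ u' i.
  rewrite mdegE -prodrXr -big_split /=; apply: eq_bigr => i _.
  by rewrite -exprMn mulrC divfK.
rewrite !wE duv; congr (_ * _); apply: eq_bigr => i _.
rewrite -(expr_mod _ (mun i)) -[in RHS](expr_mod _ (mun i)); congr (_ ^+ _).
by move: i; apply: ord3P.
Qed.

(** Different degrees are separated by the scalar 2; for equal degrees, some exponents differ modulo
    n, and scaling that one variable by [zeta] tells them apart. *)
Lemma separating_weight u v : mnm_class u <> mnm_class v ->
  exists2 lam, torsion_scaling lam & weight lam u != weight lam v.
Proof.
move=> uv; have [duv|duv] := eqVneq (mdeg u) (mdeg v); last first.
  exists (fun _ => 2%:R); first by split=> // i; rewrite pnatr_eq0.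
  rewrite /weight !prodrXr -!mdegE -!natrX eqr_nat.
  by rewrite eqn_exp2l.
have [i uvi] : exists i, (u i != v i %[mod n])%N.
  apply: contrapT => nouv; apply: uv; rewrite /mnm_class duv.
  have e i : (u i = v i %[mod n])%N.
    by apply/eqP; apply: contrapT => /negP ne; apply: nouv; exists i.
  by rewrite !e.
exists (fun j => if j == i then zeta else 1).
  split=> [j|j k]; first by case: (j == i);
    rewrite ?oner_eq0 // (prim_root_eq0 prim_zeta) -lt0n.
  suff e l : (if l == i then zeta else 1) ^+ n = 1 by rewrite !e.
  by case: (l == i); rewrite ?expr1n ?(prim_expr_order prim_zeta).
have wE w : weight (fun j => if j == i then zeta else 1) w = zeta ^+ w i.
  rewrite /weight (bigD1 i) //= eqxx big1 ?mulr1 // => j /negPf->.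
  by rewrite expr1n.
by rewrite !wE (eq_prim_root_expr prim_zeta).
Qed.

(* Lagrange interpolation in the commuting operators scale_vars lam kills the
   monomials of l outside the class of v. *)
Lemma isotypic_projection m f v (l : seq 'X_{1..3}) : vanishing_order_ge n m f ->
  exists f', [/\ vanishing_order_ge n m f',
    forall u, mnm_class u = mnm_class v -> f'@_u = f@_u,
    forall u, u \in l -> mnm_class u <> mnm_class v -> f'@_u = 0
    & forall u, f@_u = 0 -> f'@_u = 0].
Proof.
move=> fm; elim: l => [|w l [f' [f'm eq_f' f'l f'0]]]; first by exists f.
have [wv|/eqP wv] := eqVneq (mnm_class w) (mnm_class v).
  exists f'; split=> // u; rewrite inE => /orP[/eqP-> //|]; exact: f'l.
have [lam lamP lamwv] := separating_weight wv.
pose c := (weight lam v - weight lam w)^-1.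
have fE u : (c *: (scale_vars lam f' - weight lam w *: f'))@_u =
    c * (weight lam u - weight lam w) * f'@_u.
  by rewrite mcoeffZ mcoeffB mcoeffZ mcoeff_scale_vars -mulrBl mulrA.
exists (c *: (scale_vars lam f' - weight lam w *: f')); split.
- move=> h h_arc; rewrite -!mul_mpolyC rmorphM; apply: order_geMl.
  rewrite rmorphB rmorphM; apply: order_geD.
    by apply: vanishing_order_ge_scale h_arc.
  by apply: order_geN; apply: order_geMl; apply: f'm.
- move=> u uv; rewrite fE (weight_class lamP uv) mulVf ?mul1r ?eq_f' //.
  by rewrite subr_eq0 eq_sym.
- move=> u; rewrite inE fE => /orP[/eqP->|ul] uv; last by rewrite f'l ?mulr0.
  by rewrite subrr mulr0 mul0r.
- by move=> u /f'0 e; rewrite fE e mulr0.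
Qed.

Definition isotypic_part f v : S := \sum_(u <- msupp f | mnm_class u == mnm_class v)
  f@_u *: 'X_[u].

Lemma isotypic_part_vanishing m f v :
  vanishing_order_ge n m f -> vanishing_order_ge n m (isotypic_part f v).
Proof.
move=> /(isotypic_projection v (msupp f)) [f' [f'm eq_f' f'f f'0]].
suff -> : isotypic_part f v = f' by [].
apply/mpolyP => u; rewrite raddf_sum /=.
under eq_bigr do rewrite mcoeffZ mcoeffX.
have [uf|uf] := boolP (u \in msupp f); last first.
  rewrite (f'0 _ (memN_msupp_eq0 uf)) big_seq_cond big1 // => w /andP[wf _].
  by rewrite (_ : w == u = false) ?mulr0 //; apply: contraNF uf => /eqP <-.
have [uv|uv] := eqVneq (mnm_class u) (mnm_class v); last first.
  rewrite (f'f _ uf (elimN eqP uv)) big1 // => w wv.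
  by rewrite (_ : w == u = false) ?mulr0 //; apply: contraNF uv => /eqP <-.
rewrite eq_f' // big_mkcond (bigD1_seq u uf (msupp_uniq _)) /= uv !eqxx mulr1.
rewrite big1 ?addr0 // => w /negPf wu; rewrite wu mulr0.
by case: ifP.
Qed.

Lemma isotypic_decomposition f :
  f = \sum_(k <- undup [seq mnm_class u | u <- msupp f])
        \sum_(u <- msupp f | mnm_class u == k) f@_u *: 'X_[u].
Proof.
rewrite (exchange_big_dep predT) //= [LHS]mpolyE big_seq [RHS]big_seq.
apply: eq_bigr => u uf;
  have ku : mnm_class u \in undup [seq mnm_class u | u <- msupp f].
  by rewrite mem_undup map_f.
rewrite big_mkcond (bigD1_seq _ ku (undup_uniq _)) /= eqxx big1 ?addr0 // => k.
by rewrite eq_sym => /negPf->.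
Qed.

Local Notation fat_form := (@fat_form K n).
Local Notation power_subst := (@power_subst K n).
Local Notation unit_arc := (@unit_arc K).
Local Notation weight_arc := (@weight_arc K).

Lemma fermat_arc_unit : fermat_arc n unit_arc.
Proof.
exists (fun _ => 1), o0 => [|i]; last by rewrite unit_arc_coef0 mpolyC1 mul1r.
by left; split=> // i; rewrite oner_eq0.
Qed.

Lemma fermat_arc_weight (j : 'I_3) : fermat_arc n (weight_arc (fun i => (i != j) :
  nat)).
Proof.
exists (fun i => (i == j)%:R), j => [|i].
  by right; exists j => [|i /negPf->] //; rewrite eqxx oner_eq0.
rewrite weight_arcE; have [->|ij] := eqVneq i j;
  rewrite -horner_coef0 hornerM hornerC /=.
  by rewrite hornerC mulr1 mpolyC1 mul1r.
by rewrite hornerX mulr0 mpolyC0 mul0r.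
Qed.

Lemma weight_arc_monomial (w : 'I_3 -> nat) i j k :
  arc_eval (weight_arc w) (x ^+ i * y ^+ j * z ^+ k) =
  (x ^+ i * y ^+ j * z ^+ k)%:P * 'X^(w o0 * i + w o1 * j + w o2 * k).
Proof.
rewrite !rmorphM !rmorphXn /= !arc_evalX !weight_arcE !exprMn -!exprM !exprD.
by ring.
Qed.

Lemma vanishing_generated m f : vanishing_order_ge n m f ->
  ideal_gen (fat_products n x y z m m m m) f.
Proof.
move=> fm; rewrite [f]isotypic_decomposition; rewrite big_seq.
apply: ideal_gen_sum => k; rewrite mem_undup => /mapP[v vf ->].
have := isotypic_part_vanishing v fm; rewrite -/(isotypic_part f v) => fvm.
pose r i := (v i %% n)%N.
pose F : S := \sum_(u <- msupp f | mnm_class u == mnm_class v)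
  f@_u *: 'X_[[multinom (u i %/ n)%N | i < 3]].
have fvE : isotypic_part f v = x ^+ r o0 * y ^+ r o1 * z ^+ r o2 * power_subst F.
  rewrite /F rmorph_sum mulr_sumr; apply: eq_bigr => u /eqP[_ u0 u1 u2].
  rewrite -!mul_mpolyC rmorphM power_substC mulrCA; congr (_ * _).
  have X3 w : 'X_[w] = x ^+ w o0 * y ^+ w o1 * z ^+ w o2 :> S.
    rewrite mpolyXE_id !big_ord_recl big_ord0 mulr1 mulrA.
    by congr ('X__ ^+ w _ * 'X__ ^+ w _ * 'X__ ^+ w _); apply: val_inj.
  rewrite (X3 u) (X3 [multinom _ | i < 3]) !rmorphM !rmorphXn /= !power_substX !mnmE
    -!exprM.
  rewrite /r -u0 -u1 -u2 !(mulnC n).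
  rewrite {1}(divn_eq (u o0) n) {1}(divn_eq (u o1) n) {1}(divn_eq (u o2) n) !exprD.
  by ring.
have lead : ((x ^+ r o0 * y ^+ r o1 * z ^+ r o2)%:P : {poly S})`_0 != 0.
  by rewrite coefC /= !mulf_neq0 // expf_neq0 // mpolyX_neq0.
(* The monomial of residues is a unit at (1:1:1) and costs r1 + r2, r0 + r2, r0 + r1 at the
   coordinate points. What is left need not be a multiple of n, hence the independent a, b, c. One
   general point suffices, as all n^2 have the same image under n-th powers. *)
have FF : fat_form ((mdeg v - (r o0 + r o1 + r o2)) %/ n) m
    (m - (r o1 + r o2)) (m - (r o0 + r o2)) (m - (r o0 + r o1)) F.
  split.
  - apply: rpred_sum => u /eqP[duv u0 u1 u2]; apply: rpredZ.
    rewrite dhomogX /= -duv !mdeg3 !mnmE /r -u0 -u1 -u2.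
    have e0 := divn_eq (u o0) n; have e1 := divn_eq (u o1) n.
    have e2 := divn_eq (u o2) n.
    rewrite -[X in X == _](mulnK _ n_gt0); apply/eqP; congr (_ %/ _)%N.
    move: e0 e1 e2; move: (u o0 %/ n)%N (u o1 %/ n)%N (u o2 %/ n)%N => q0 q1 q2.
    move: (u o0 %% n)%N (u o1 %% n)%N (u o2 %% n)%N => r0 r1 r2 -> -> ->.
    by rewrite !mulnDl; lia.
  - have := fvm _ fermat_arc_unit; rewrite fvE rmorphM mulrC; apply: order_ge_cancel.
    rewrite !rmorphM !rmorphXn /= !arc_evalX -horner_coef0 !hornerM !horner_exp.
    by rewrite !horner_coef0 !unit_arc_coef0 -!exprD expf_neq0 ?mpolyX_neq0.
  - have := fvm _ (fermat_arc_weight o0); rewrite fvE rmorphM mulrC.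
    by rewrite weight_arc_monomial => /(order_ge_cancelX lead); rewrite /= mul0n !mul1n.
  - have := fvm _ (fermat_arc_weight o1); rewrite fvE rmorphM mulrC.
    by rewrite weight_arc_monomial => /(order_ge_cancelX lead);
      rewrite /= mul0n !mul1n ?addn0.
  - have := fvm _ (fermat_arc_weight o2); rewrite fvE rmorphM mulrC.
    by rewrite weight_arc_monomial => /(order_ge_cancelX lead);
      rewrite /= mul0n !mul1n ?addn0.
have := fat_form_generated n_gt0 FF.
rewrite -/(isotypic_part f v) fvE.
apply: ideal_gen_mul => _ [i [j [k' [al [be [ga [vld ->]]]]]]].
apply: mem_ideal_gen; exists (r o0 + i)%N, (r o1 + j)%N, (r o2 + k')%N, al, be, ga.
split; last by rewrite fermat_prodXn.
by case/and4P: vld => h1 h2 h3 h4; apply/and4P; split=> //; lia.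
Qed.

End Isotypic.

(** * Generators of the symbolic powers *)

Section FermatSymbolicPower.
Variables (K : numFieldType) (n : nat) (zeta : K).
Hypotheses (n_ge3 : (3 <= n)%N) (prim_zeta : n.-primitive_root zeta).

Local Notation S := {mpoly K[3]}.
Local Notation I := (fermat_ideal K n).
Local Notation x := ('X_o0 : S).
Local Notation y := ('X_o1 : S).
Local Notation z := ('X_o2 : S).
Implicit Types (f : S).

Let n_gt0 : (0 < n)%N. Proof. exact: leq_trans n_ge3. Qed.

(** Degree at most n + 1 < 2n leaves exactly one factor among u, v, w and at most one variable. If
    the factor is u, the conditions at (0:1:0) and (0:0:1) force that variable to be x; likewise yv
    and zw. *)
Lemma low_fat_products1 : low_fat_products n x y z 1 `<=` I.
Proof.
have [Ixu Iyv Izw] := fermat_ideal_gens K n.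
move=> _ [i [j [k [al [be [ga [/and4P[h1 h2 h3 h4] le ->]]]]]]].
have s2 : (al + be + ga < 2)%N.
  rewrite ltnNge; apply/negP => s2;
    have : (n * 2 <= n * (al + be + ga))%N by rewrite leq_mul2l s2 orbT.
  by lia.
have [al1|al0] := posnP al; last first.
  have [be0 ga0] : be = 0%N /\ ga = 0%N by lia.
  have al1 : al = 1%N by lia.
  rewrite al1 be0 ga0 in h3 h4 le *; case: i h2 h3 h4 le => [|i] *; first by exfalso;
    lia.
  by rewrite fermat_prodx fermat_produ mulrA; apply: ideal_genMr.
have [be1|be0] := posnP be; last first.
  have ga0 : ga = 0%N by lia.
  have be1 : be = 1%N by lia.
  rewrite al1 be1 ga0 in h2 h4 le *; case: j h2 h3 h4 le => [|j] *; first by exfalso;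
    lia.
  by rewrite fermat_prody fermat_prodv mulrA; apply: ideal_genMr.
have ga1 : ga = 1%N by lia.
rewrite al1 be1 ga1 in h2 h3 le *; case: k h2 h3 h4 le => [|k] *; first by exfalso; lia.
by rewrite fermat_prodz fermat_prodw mulrA; apply: ideal_genMr.
Qed.

(** Suppose xf, yf, zf lie in I. On every arc some coordinate has nonzero constant coefficient, so f
    vanishes to order 1; then f is a combination of products of degree at most n + 1, hence f is in
    I and p contains 1. *)
Lemma associated_prime_variable p : associated_primes I p -> ~ [/\ p x, p y & p z].
Proof.
move=> [pp [f pE]] pxyz.
have {pxyz} If i : I ('X_i * f).
  by case: pxyz; rewrite pE /=; move: i; apply: ord3P.
suff : p 1 by case: pp => [[_ /negP p1 _] _] /mem_set.
rewrite pE /= mul1r.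
apply: (@ideal_gen_sub _ (low_fat_products n x y z 1) _ _ f).
  by move=> g /low_fat_products1 Ig; exact: Ig.
apply: fat_products_low => //; apply: (vanishing_generated n_gt0 prim_zeta).
move=> h h_arc; have [a [j a_pt h0]] := h_arc.
have [i ai] := fermat_point_neq0 a_pt.
have := arc_eval_fermat_ideal n_gt0 h_arc (If i).
rewrite rmorphM arc_evalX mulrC; apply: order_ge_cancel.
by rewrite h0 mulf_neq0 ?mpolyC_eq0 ?mpolyX_neq0.
Qed.

(** At a coordinate point r and s are the local coordinates and u, v are units, so ru, sv in J put r
    and s locally in J, and r^n - s^n in J^n. The stated powers of u and v are the denominators. *)
Lemma ideal_pow_near_point (T : comNzRingType) (J : set T) (r s u v : T) i j ga :
  J (r * u) -> J (s * v) ->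
  ideal_pow J (n * ga + i + j)
    (u ^+ (n * ga + i) * v ^+ (n * ga + j) * (r ^+ i * s ^+ j * (r ^+ n - s ^+ n) ^+
      ga)).
Proof.
move=> Jru Jsv.
have -> : u ^+ (n * ga + i) * v ^+ (n * ga + j) * (r ^+ i * s ^+ j * (r ^+ n - s ^+ n)
  ^+ ga) =
   (v ^+ n * (r * u) ^+ n - u ^+ n * (s * v) ^+ n) ^+ ga * (r * u) ^+ i * (s * v) ^+ j.
  have -> : v ^+ n * (r * u) ^+ n - u ^+ n * (s * v) ^+ n =
      u ^+ n * v ^+ n * (r ^+ n - s ^+ n) by rewrite !exprMn; ring.
  by rewrite !exprMn !exprD -!exprM; ring.
have JX r' k : J r' -> ideal_pow J k (r' ^+ k).
  by move=> Jr'; have := ideal_powX k (ideal_pow1 Jr'); rewrite mul1n.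
apply: ideal_powM (JX _ _ Jsv); apply: ideal_powM (JX _ _ Jru).
by apply/ideal_powX/ideal_genB; apply: ideal_genMl; apply: JX.
Qed.

Lemma fat_products_symbolic m : fat_products n x y z m m m m `<=` symbolic_power I m.
Proof.
have [Ixu Iyv Izw] := fermat_ideal_gens K n.
move=> _ [i [j [k [al [be [ga [/and4P[h1 h2 h3 h4] ->]]]]]]].
apply/symbolic_powerP => p Ip; have [pp [f pE]] := Ip.
have pI g : I g -> p g by rewrite pE /=; apply: ideal_genMr.
have nxyz := associated_prime_variable Ip.
have pD g h : p (g - h) -> p h -> p g.
  by move=> pgh ph; rewrite -(subrK h g); apply: prime_ideal_add.
have pN g h : p (g - h) -> p (h - g).
  by move=> /(prime_ideal_mul (-1) pp); rewrite mulN1r opprB.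
have pX g : p g -> p (g ^+ n).
  move=> pg; rewrite -(prednK n_gt0) exprSr; exact: prime_ideal_mul.
have pnX g e : ~ p g -> ~ p (g ^+ e) by move=> pg /(prime_idealX pp).
have pnM g h : ~ p g -> ~ p h -> ~ p (g * h) by move=> pg ph /(prime_idealM pp) [].
have pow g h : p (g ^+ n - h ^+ n) -> p h -> p g.
  by move=> gh /pX /(pD _ _ gh) /(prime_idealX pp).
(* One variable in p brings a second: if x is in p and y is not, then yv in p gives z^n - x^n in p,
   hence z in p. So p contains none or exactly two of the variables. *)
have px_yz : p x -> ~ p y -> p z.
  by move=> px npy; case: (prime_idealM pp (pI _ Iyv)) => // /pow; apply.
have py_zx : p y -> ~ p z -> p x.
  by move=> px npy; case: (prime_idealM pp (pI _ Izw)) => // /pow; apply.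
have pz_xy : p z -> ~ p x -> p y.
  by move=> px npy; case: (prime_idealM pp (pI _ Ixu)) => // /pow; apply.
have [px|npx] := pselect (p x); have [py|npy] := pselect (p y).
- have npz : ~ p z by move=> pz; apply: nxyz.
  exists ((y ^+ n - z ^+ n) ^+ (n * ga + i) * (z ^+ n - x ^+ n) ^+ (n * ga + j)).
    by apply: (pnM); apply: pnX; [move/pN/pow|move/pow]; auto.
  apply: (ideal_pow_leq h4).
  have := @ideal_genMr _ _ (z ^+ k * (y ^+ n - z ^+ n) ^+ al * (z ^+ n - x ^+ n) ^+
    be) _
     (ideal_pow_near_point i j ga Ixu Iyv).
  by congr (ideal_gen _ _); rewrite /fermat_prod; ring.
- have pz := px_yz px npy.
  exists ((x ^+ n - y ^+ n) ^+ (n * be + k) * (y ^+ n - z ^+ n) ^+ (n * be + i)).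
    by apply: (pnM); apply: pnX; [move/pN/pow|move/pow]; auto.
  rewrite -addnA (addnC i) addnA in h3; apply: (ideal_pow_leq h3).
  have := @ideal_genMr _ _ (y ^+ j * (y ^+ n - z ^+ n) ^+ al * (x ^+ n - y ^+ n) ^+
    ga) _
     (ideal_pow_near_point k i be Izw Ixu).
  by congr (ideal_gen _ _); rewrite /fermat_prod; ring.
- have [pz|npz] := pselect (p z); last by case: npx; apply: py_zx.
  exists ((z ^+ n - x ^+ n) ^+ (n * al + j) * (x ^+ n - y ^+ n) ^+ (n * al + k)).
    by apply: (pnM); apply: pnX; [move/pN/pow|move/pow]; auto.
  apply: (ideal_pow_leq h2).
  have := @ideal_genMr _ _ (x ^+ i * (z ^+ n - x ^+ n) ^+ be * (x ^+ n - y ^+ n) ^+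
    ga) _
     (ideal_pow_near_point j k al Iyv Izw).
  by congr (ideal_gen _ _); rewrite /fermat_prod; ring.
- have npz : ~ p z by move=> pz; apply: npy; apply: pz_xy.
  (* With no variable in p, the forms u, v, w lie in I locally, since xu, yv, zw do. *)
  exists (x ^+ al * y ^+ be * z ^+ ga); first by do 2?apply: (pnM); apply: pnX.
  apply: (ideal_pow_leq h1).
  have JX r k' : I r -> ideal_pow I k' (r ^+ k').
    by move=> Ir; have := ideal_powX k' (ideal_pow1 Ir); rewrite mul1n.
  have := ideal_genMr (x ^+ i * y ^+ j * z ^+ k)
    (ideal_powM (ideal_powM (JX _ al Ixu) (JX _ be Iyv)) (JX _ ga Izw)).
  by congr (ideal_gen _ _); rewrite /fermat_prod !exprMn; ring.
Qed.

Lemma symbolic_power_generated m : (1 <= m)%N ->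
  symbolic_power I m = ideal_gen (low_fat_products n x y z m).
Proof.
move=> m_gt0; apply/seteqP; split=> [f If|].
  apply: fat_products_low => //; apply: (vanishing_generated n_gt0 prim_zeta).
  exact: symbolic_power_vanishing.
apply: ideal_gen_min; [exact: symbolic_power0|exact: symbolic_powerD
  |exact: symbolic_powerMl|].
move=> _ [i [j [k [al [be [ga [vld _ ->]]]]]]]; apply: fat_products_symbolic.
by exists i, j, k, al, be, ga.
Qed.

End FermatSymbolicPower.

(** * Degrees of minimal generators *)

Lemma fermat_prod_homog (K : fieldType) n i j k al be ga :
  fermat_prod n ('X_o0 : {mpoly K[3]}) 'X_o1 'X_o2 i j k al be ga
    \is (i + j + k + n * (al + be + ga)).-homog.
Proof.
have homX (p : {mpoly K[3]}) d e : p \is d.-homog -> p ^+ e \is (d * e).-homog.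
  exact: dhomogMn.
have X1 l : 'X_l \is [in K[3], 1.-homog] by rewrite dhomogX /= mdeg1.
have Xn l : 'X_l ^+ n \is [in K[3], n.-homog].
  by have := homX _ _ n (X1 l); rewrite mul1n.
have Bn l l' : 'X_l ^+ n - 'X_l' ^+ n \is [in K[3], n.-homog] by apply: rpredB.
have X1e l e : 'X_l ^+ e \is [in K[3], e.-homog].
  by have := homX _ _ e (X1 l); rewrite mul1n.
rewrite !mulnDr !addnA /fermat_prod.
by do 3!(apply: dhomogM; last exact: homX); do 2!(apply: dhomogM; last exact: X1e).
Qed.

Lemma low_fat_products_seq (K : fieldType) n m : (0 < n)%N ->
  exists G : seq {mpoly K[3]},
    [set` G] = low_fat_products n ('X_o0 : {mpoly K[3]}) 'X_o1 'X_o2 m.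
Proof.
move=> n_gt0; pose N := (m * (n + 1)).+1.
pose F (e : ('I_N * 'I_N * 'I_N) * ('I_N * 'I_N * 'I_N)) : {mpoly K[3]} :=
  fermat_prod n 'X_o0 'X_o1 'X_o2 e.1.1.1 e.1.1.2 e.1.2 e.2.1.1 e.2.1.2 e.2.2.
pose P (e : ('I_N * 'I_N * 'I_N) * ('I_N * 'I_N * 'I_N)) :=
  fat_exponents n m m m m e.1.1.1 e.1.1.2 e.1.2 e.2.1.1 e.2.1.2 e.2.2 &&
  (e.1.1.1 + e.1.1.2 + e.1.2 + n * (e.2.1.1 + e.2.1.2 + e.2.2) <= m * (n + 1))%N.
exists [seq F e | e <- enum P]; apply/seteqP; split=> f /=.
  case/mapP=> e; rewrite mem_enum => /andP[vld le] ->.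
  by do 6!eexists; split; [exact: vld|exact: le|].
move=> [i [j [k [al [be [ga [vld le ->]]]]]]].
have bound e : (e <= i + j + k + (al + be + ga))%N -> (e < N)%N.
  move=> h; rewrite ltnS (leq_trans h) // (leq_trans _ le) // leq_add2l.
  by rewrite leq_pmull.
have [bi bj bk] : [/\ i < N, j < N & k < N]%N by split; apply: bound; lia.
have [ba bb bc] : [/\ al < N, be < N & ga < N]%N by split; apply: bound; lia.
apply/mapP; exists ((Ordinal bi, Ordinal bj, Ordinal bk), (Ordinal ba, Ordinal bb,
  Ordinal bc)) => //.
by rewrite mem_enum unfold_in /P /= vld le.
Qed.

Lemma size_of_roots (K : fieldType) (m : nat) (cs : seq K) (p : {poly K}) :
  uniq cs -> p != 0 -> (forall c, c \in cs -> order_ge m (p \Po ('X + c%:P))) ->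
  (m * size cs < size p)%N.
Proof.
elim: cs p => [|c cs IH] p /=; first by rewrite muln0 size_poly_gt0.
move=> /andP[ccs ucs] p0 pcs.
have [q pE] : exists q, p = q * ('X - c%:P) ^+ m.
  have [q qE] := pcs c (mem_head _ _); exists (q \Po ('X - c%:P)).
  rewrite -[LHS]comp_polyXr -[X in _ \Po X](subrK c%:P).
  have -> : 'X - c%:P + c%:P = ('X + c%:P) \Po ('X - c%:P) :> {poly K}.
    by rewrite rmorphD /= comp_polyX comp_polyC.
  by rewrite comp_polyA qE rmorphM rmorphXn /= comp_polyX.
have q0 : q != 0 by apply: contraNneq p0 => q0; rewrite pE q0 mul0r.
rewrite pE size_mul ?expf_neq0 ?polyXsubC_eq0 // size_exp_XsubC addnS /=.
rewrite mulnS addnC ltn_add2r; apply: IH => // c' c'cs.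
have := pcs c'; rewrite inE c'cs orbT => /(_ isT); rewrite pE rmorphM /=.
apply: order_ge_cancel; rewrite -horner_coef0 horner_comp horner_exp.
rewrite !hornerE expf_neq0 // subr_eq0.
by apply: contraNneq ccs => <-.
Qed.

Section Degrees.
Variables (K : numFieldType) (n : nat) (zeta : K).
Hypotheses (n_ge3 : (3 <= n)%N) (prim_zeta : n.-primitive_root zeta).

Local Notation S := {mpoly K[3]}.
Local Notation I := (fermat_ideal K n).
Local Notation x := ('X_o0 : S).
Local Notation y := ('X_o1 : S).
Local Notation z := ('X_o2 : S).
Implicit Types (f : S).

Let n_gt0 : (0 < n)%N. Proof. exact: leq_trans n_ge3. Qed.

Let line : {rmorphism S -> {poly K}} :=
  mmap (@polyC K) (fun i : 'I_3 => if i == o0 then 1 else 'X).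

(* The line y = z contains the n + 1 Fermat points (1 : c : c), c^n = 1 or c = 0. *)
Lemma line_eq0 m f : symbolic_power I m f -> ((msize f).-1 < m * (n + 1))%N ->
  line f = 0.
Proof.
move=> /(symbolic_power_vanishing n_gt0) fm deg_f.
apply: contraTeq deg_f => lf0; rewrite -leqNgt.
have lineX i : line 'X_i = if i == o0 then 1 else 'X by exact: mmap_X.
have size_lf : (size (line f) <= msize f)%N.
  rewrite /line /= mmap3E /=; apply: (leq_trans (size_sum _ _ _)).
  apply/bigmax_leqP_seq => u uf _; rewrite expr1n mul1r -exprD mul_polyC.
  apply: (leq_trans (size_scale_leq _ _)); rewrite size_polyXn.
  apply: leq_trans (msize_mdeg_lt uf); rewrite ltnS mdeg3.
  by rewrite -addnA leq_addl.
pose cs := 0 :: [seq zeta ^+ i | i <- iota 0 n].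
have size_cs : size cs = (n + 1)%N by rewrite /= size_map size_iota addn1.
rewrite -size_cs -ltnS (leq_trans _ (leqSpred _)) // (leq_trans _ size_lf) //.
have zeta0 : zeta != 0 by rewrite (prim_root_eq0 prim_zeta) -lt0n.
apply: size_of_roots => // [|c ccs].
  rewrite /= map_inj_in_uniq ?iota_uniq ?andbT => [|i j].
    by apply/mapP => -[i _ /esym/eqP]; rewrite expf_eq0 (negPf zeta0) andbF.
  rewrite !mem_iota !add0n => /andP[_ lti] /andP[_ ltj] /eqP.
  by rewrite (eq_prim_root_expr prim_zeta) !modn_small // => /eqP.
(* This arc moves inside the line y = z from (1:c:c). With the variables of S set to 1 it becomes
   the expansion at c of the restriction of f. *)
pose h (i : 'I_3) : {poly S} := if i == o0 then x%:P else (c%:MP * x)%:P + 'X.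
have h_arc : fermat_arc n h.
  exists (fun i => if i == o0 then 1 else c), o0 => [|i].
    move: ccs; rewrite inE => /predU1P[->|/mapP[j _ ->]].
      right; exists o0 => [|i /negPf->] //; first by rewrite /= oner_eq0.
    have zn : (zeta ^+ j) ^+ n = 1 by rewrite exprAC (prim_expr_order prim_zeta) expr1n.
    left; split=> [i|i k]; first by case: (i == o0); rewrite ?oner_eq0 ?expf_neq0.
    by case: (i == o0); case: (k == o0); rewrite ?expr1n ?zn.
  rewrite /h; case: (i == o0); first by rewrite coefC mpolyC1 mul1r.
  by rewrite coefD coefC coefX addr0.
pose ev := mmap (idfun : {rmorphism K -> K}) (fun _ : 'I_3 => 1).
suff -> : line f \Po ('X + c%:P) = map_poly ev (arc_eval h f).
  by apply: order_ge_map; apply: fm.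
apply: (@mpoly_rmorph_ext _ _ _ (comp_poly ('X + c%:P) \o line) (map_poly ev \o
  arc_eval h)) => [k|i] /=.
  by rewrite arc_evalC map_polyC /= !mmapC comp_polyC.
rewrite arc_evalX lineX /h; case: (i == o0).
  by rewrite map_polyC /= mmap_X comp_polyC.
by rewrite rmorphD /= map_polyC /= rmorphM /= mmapC mmap_X map_polyX comp_polyX mulr1
  addrC.
Qed.

Lemma fermat_omega m : (1 <= m)%N -> omega (symbolic_power I m) = (m * (n + 1))%N.
Proof.
move=> m_gt0; have Igen := symbolic_power_generated n_ge3 prim_zeta m_gt0.
have [G0 G0E] := low_fat_products_seq K m n_gt0.
have low_homog g : low_fat_products n x y z m g ->
    exists2 d, (d <= m * (n + 1))%N & g \is d.-homog.
  move=> [i [j [k [al [be [ga [_ le ->]]]]]]].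
  exists (i + j + k + n * (al + be + ga))%N => //; exact: fermat_prod_homog.
(* Without this, the choice in [omega] could fall back on the empty list. *)
have exG : exists G, minimal_homogeneous_generators (symbolic_power I m) G.
  rewrite Igen -G0E; apply: exists_minimal_homogeneous_generators => g gG0.
  have : [set` G0] g by [].
  by rewrite G0E => /low_homog[d _ gd]; exists d.
rewrite /omega; set G := xget _ _.
have GP : minimal_homogeneous_generators (symbolic_power I m) G by exact: xgetPex.
apply/eqP; rewrite eqn_leq; apply/andP; split.
  apply/bigmax_leqP_seq => g gG _.
  exact: minimal_generator_degree_le Igen low_homog GP g gG.
rewrite leqNgt; apply/negP => lt_G.
have lineG g : g \in G -> line g = 0.
  move=> gG; apply: (@line_eq0 m).
    by case: GP => _ <- _; apply: mem_ideal_gen.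
  by apply: leq_ltn_trans lt_G;
    apply: (leq_bigmax_seq (F := fun g : S => (msize g).-1)).
have line0 f : symbolic_power I m f -> line f = 0.
  case: GP => _ <- _; apply: (@ideal_gen_min _ _ [set f | line f = 0]) => /=.
  - exact: rmorph0.
  - by move=> f1 f2 e1 e2; rewrite rmorphD /= e1 e2 addr0.
  - by move=> h f1 e1; rewrite rmorphM /= e1 mulr0.
  - exact: lineG.
have : line (fermat_prod n x y z 0 m 0 0 m 0) = 0.
  apply: line0; rewrite Igen; apply: mem_ideal_gen.
  exists 0%N, m, 0%N, 0%N, m, 0%N; split=> //.
    by apply/and4P; split; rewrite ?muln0 ?add0n ?addn0 // leq_pmull.
  by rewrite !addn0 !add0n mulnDr muln1 (mulnC m) addnC.
move/eqP; apply/negP; rewrite rmorph_fermat_prod /line /= !mmap_X /= /fermat_prod.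
rewrite !expr0 mul1r !mulr1 expr1n mulf_neq0 // expf_neq0 ?polyX_eq0 //.
by rewrite -size_poly_eq0 size_XnsubC.
Qed.

End Degrees.

Lemma exists_primitive_root (K : numClosedFieldType) n : (0 < n)%N ->
  exists zeta : K, n.-primitive_root zeta.
Proof.
move=> n_gt0.
have [r rE] := closed_field_poly_normal ('X^n - 1 : {poly K}).
have lc : lead_coef ('X^n - 1 : {poly K}) = 1.
  by rewrite lead_coefDl ?lead_coefXn // size_polyXn size_polyN size_poly1 ltnS.
rewrite lc scale1r in rE.
have size_r : size r = n.
  by have := size_XnsubC (1 : K) n_gt0; rewrite rE size_prod_XsubC => -[].
have r_unity : all n.-unity_root r.
  apply/allP => c cr; rewrite unity_rootE -subr_eq0.
  have : root (\prod_(z <- r) ('X - z%:P)) c by rewrite root_prod_XsubC.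
  by rewrite -rE /root !hornerE.
have r_uniq : uniq r.
  rewrite -separable_prod_XsubC -rE; apply: separable_Xn_sub_1.
  by rewrite pnatr_eq0 -lt0n.
have := has_prim_root n_gt0 r_unity r_uniq;
  rewrite size_r leqnn => /(_ isT) /hasP[c _ cP].
by exists c.
Qed.

Local Close Scope ring_scope.
Local Close Scope classical_set_scope.

Theorem corollary3p12 (R : realType) :
  (forall n m : nat, 3 <= n -> 1 <= m ->
     m * (n + 1) <= omega (symbolic_power (fermat_ideal (complex R) n) m)) /\
  (forall n : nat, 3 <= n -> forall m : nat, n ^ 2 - 3 * n + 2 <= m ->
     omega (symbolic_power (fermat_ideal (complex R) n) m) = m * (n + 1)).
Proof.
have omegaE n m : 3 <= n -> 1 <= m ->
    omega (symbolic_power (fermat_ideal (complex R) n) m) = m * (n + 1).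
  move=> n_ge3; have n_gt0 : 0 < n by exact: leq_trans n_ge3.
  have [zeta prim_zeta] := exists_primitive_root (complex R) n_gt0.
  exact: fermat_omega n_ge3 prim_zeta m.
split=> [n m n_ge3 m_gt0|n n_ge3 m le_m]; first by rewrite omegaE.
(* The summand 2 makes the bound positive whatever the truncated subtraction yields. *)
by apply: omegaE => //; apply: leq_trans le_m; rewrite addn2.
Qed.
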